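(* There exist sequences $(u_m)_{m\ge 0}$ with $u_m\in C^\infty(B_2)$ and $(A_m)_{m\ge 0}$ with $A_m\in C^\infty(B_2;\mathcal S^3)$ such that, for every $m$, $$I\le A_m(x)\le 2^{81}I\quad\text{for all }x\in B_2,\qquad A_m:D^2u_m=0\quad\text{in }B_2,$$ all $u_m$ have the same Dirichlet data $1-x_1^2/2$ on $\partial B_2$, $$\|u_m\|_{L^\infty(B_2)}\le 1\quad\text{for every }m,\qquad \lim_{m\to\infty}\|Du_m\|_{L^1(B_1)}=\infty .$$ Moreover, there is one fixed quadratic polynomial (independent of $m$) with which every $u_m$ agrees on $B_2\setminus Q_0$, where $Q_0=\left(-\tfrac12,\tfrac12\right)^3\Subset B_1$.
   Context: $B_r$ is the open ball of radius $r$ centered at the origin in $\mathbb R^3$. $\mathcal S^3$ is the space of real symmetric $3\times3$ matrices, $I$ is the identity matrix, and matrix inequalities are in the sense of quadratic forms. For $A,B\in\mathcal S^3$, $A:B=\operatorname{tr}(AB)$. $Du$ and $D^2u$ denote the gradient and the Hessian of $u$. Having Dirichlet data $\varphi$ on $\partial B_2$ means that the function extends continuously to $\overline{B_2}$ with boundary values $\varphi$. *)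

(* Defs.v *)
From mathcomp Require Import all_boot all_order all_algebra.
From mathcomp Require Import all_classical all_reals all_analysis.

Set Implicit Arguments.
Unset Strict Implicit.
Unset Printing Implicit Defensive.

Import Order.TTheory GRing.Theory Num.Theory.
Import numFieldNormedType.Exports.

Local Open Scope classical_set_scope.
Local Open Scope ring_scope.

Section Defs.
Context {R : realType}.
Implicit Types (x : 'rV[R]_3) (U : set 'rV[R]_3) (f : 'rV[R]_3 -> R).

(* The library norm [`|x|] on ['rV[R]_3] is the max norm; it induces the same
   topology as the Euclidean norm. *)
Definition enorm x : R := Num.sqrt (\sum_i x 0 i ^+ 2).

Definition eball (r : R) : set 'rV[R]_3 := [set x | enorm x < r].

Definition cubeQ0 : set 'rV[R]_3 :=
  [set x | forall i, - (1 / 2) < x 0 i < 1 / 2].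

Definition boundary U : set 'rV[R]_3 := closure U `\` interior U.

Definition partial (i : 'I_3) f : 'rV[R]_3 -> R := 'D_(delta_mx 0 i) f.

Definition gradient f x : 'rV[R]_3 := \row_i partial i f x.

Definition hessian f x : 'M[R]_3 := \matrix_(i, j) partial i (partial j f) x.

(* [f] is C^oo on the open set [U]: all iterated partial derivatives
   [foldr partial f s] exist and are continuous at every point of [U].  The
   values of [f] outside [U] are irrelevant. *)
Definition smooth_on U f : Prop :=
  forall s : seq 'I_3,
    {in U, continuous (foldr partial f s)} /\
    forall i : 'I_3,
      {in U, forall x, derivable (foldr partial f s) x (delta_mx 0 i)}.

(* [A] is in C^oo(U; S^3), S^3 being the symmetric matrices. *)
Definition smooth_sym_on U (A : 'rV[R]_3 -> 'M[R]_3) : Prop :=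
  {in U, forall x, (A x)^T = A x} /\
  forall i j, smooth_on U (fun x => A x i j).

Definition qform (A : 'M[R]_3) x : R := (x *m A *m x^T) 0 0.

Definition form_le (A B : 'M[R]_3) : Prop := forall x, qform A x <= qform B x.

Definition ddot (A B : 'M[R]_3) : R := \tr (A *m B).

Definition has_dirichlet_data U f (phi : 'rV[R]_3 -> R) : Prop :=
  exists v : 'rV[R]_3 -> R,
    [/\ {within closure U, continuous v},
        {in U, v =1 f} &
        {in boundary U, v =1 phi}].

(* Polynomials of degree exactly two. *)
Definition quadratic_polynomial (q : 'rV[R]_3 -> R) : Prop :=
  exists (M : 'M[R]_3) (b : 'rV[R]_3) (c : R),
    [/\ M^T = M, M != 0 &
        forall x, q x = qform M x + (\sum_i b 0 i * x 0 i) + c].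

(* ['rV[R]_3] carries no measurable structure in the library, so functions on
   it are integrated through their coordinates in [R * R * R]. *)
Definition vec3 (p : measurableTypeR R * measurableTypeR R * measurableTypeR R) :
  'rV[R]_3 := \row_i [:: p.1.1; p.1.2; p.2]`_i.

Definition lebesgue3 :=
  ((@lebesgue_measure R \x @lebesgue_measure R)%E \x @lebesgue_measure R)%E.

Definition Lp_norm_on U (p : \bar R) f : \bar R :=
  'N[lebesgue3]_p[ ((EFin \o f) \_ U) \o vec3 ].

End Defs.

(* Main.v *)
Require Import Defs.
From mathcomp Require Import all_boot all_order all_algebra.
From mathcomp Require Import all_classical all_reals all_analysis.
From mathcomp Require Import ess_sup_inf ring lra.
Import Order.TTheory GRing.Theory Num.Theory.
Import numFieldNormedType.Exports.
Set Implicit Arguments.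
Unset Strict Implicit.
Unset Printing Implicit Defensive.
Local Open Scope classical_set_scope.
Local Open Scope ring_scope.

(** Only diagonal matrices A are used, so the equation sees only the diagonal
    entries M = (u_00, u_11, u_22) of the Hessian, and A is taken to be the
    cross product V x M of M with an auxiliary field V.  This makes
    [A : D^2 u = 0] an identity and leaves a single thing to arrange, namely
    that the entries of V x M lie between two positive constants; such a V
    exists as soon as M has a positive and a negative entry of controlled size.
    Since V enters linearly, choices of V made on overlapping regions can be
    glued with cut-off functions.

    The solutions are self-similar.  The building block starts from a quadratic
    function with Hessian diag(-1, p, h), h = 2^-10, 0 <= p <= h, and adds three
    oscillations at the same length scale 1/k.  The first one, in direction 1,
    produces slabs on which u_11 is about -L, with L of order k^2; it is
    harmless because u_00 < 0 < u_22 persists.  On these slabs u_11 < 0 < u_22,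
    which leaves direction 0 free: a second oscillation produces rods on which
    u_00 is about L h.  On the rods u_11 < 0 < u_00, which leaves direction 2
    free, and a third oscillation yields (k/16)^3 small cubes of relative size
    1/(4k) on which the Hessian is exactly L diag(h, -1, h'), h' = 2^-18.  Up to
    the factor L and a cyclic permutation of the axes this is again of the form
    diag(-1, h', h), so a rescaled copy of the construction is inserted in each
    cube, and so on ([corrector], [coefficient_range]).

    Amplitudes are bounded by those of a geometric series of ratio L/(4k)^2,
    whence the sup bound ([corrector_small]).  On each of the (k/16)^(3m) cubes
    of generation m, of size (4k)^-m, some component of the gradient is affine
    with slope L^m ([unit_grad_affine]), so such a cube contributes at least a
    multiple of L^m (4k)^(-4m) to the L^1 norm of the gradient ([L1_lower]).
    With k = 2^40 and L = h k^2 / 512 = 2^61 the total is a multiple of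
    (L (k/16)^3 / (4k)^4)^m = 2^m, while the entries of A stay below
    2^20 L = 2^81.  The one-dimensional cut-offs need explicit bounds on their
    second derivatives; they are obtained by integrating twice a plateau
    function ([controlled_step_exists]).

    Outside the cube every solution is the quadratic function
    1 - x_0^2/2 + t (|x|^2 - 4), which has the right values on the sphere for
    every t; t is fixed by requiring that its Hessian is proportional to
    diag(-1, h, h). *)

(** * Smooth functions along a family of directions *)

Section Smoothness.
Context {R : realType} {V : normedModType R} {I : Type} (e : I -> V).
Implicit Types (f g : V -> R) (n : nat).

(** Smoothness is expressed through iterated derivatives along given directions,
    so that functions of one real variable and of three real variables are
    covered by the same closure lemmas. *)
Fixpoint Cn n f : Prop :=
  continuous f /\
  if n is n'.+1 then
    forall i, (forall x, derivable f x (e i)) /\ Cn n' ('D_(e i) f)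
  else True.

Definition smooth f := forall n, Cn n f.

Lemma CnS n f (df : I -> V -> R) : continuous f ->
  (forall i x, is_derive x (e i) f (df i x)) -> (forall i, Cn n (df i)) ->
  Cn n.+1 f.
Proof.
move=> cf fdf Cdf; split => // i; split=> [x|].
  by have [] := fdf i x.
have -> : 'D_(e i) f = df i.
  by apply/funext => x; rewrite (@derive_val _ _ _ _ _ _ _ (fdf i x)).
exact: Cdf.
Qed.

Lemma CnS_derive n f i x : Cn n.+1 f -> is_derive x (e i) f ('D_(e i) f x).
Proof. by move=> [_ /(_ i)[df _]]; exact/derivableP. Qed.

Lemma Cn_continuous n f : Cn n f -> continuous f.
Proof. by case: n => [|n] []. Qed.

Lemma CnW n f : Cn n.+1 f -> Cn n f.
Proof.
elim: n f => [|n IHn] f [cf Hf]; split=> // i.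
by have [df /IHn] := Hf i.
Qed.

Lemma Cn_cst n (a : R) : Cn n (cst a).
Proof.
elim: n a => [|n IHn] a; first by split=> // x; exact: cvg_cst.
by apply: (@CnS _ _ (fun=> cst 0)) => // x; exact: cvg_cst.
Qed.

Lemma CnD n f g : Cn n f -> Cn n g -> Cn n (f \+ g).
Proof.
elim: n f g => [|n IHn] f g Hf Hg; have cf := Cn_continuous Hf;
  have cg := Cn_continuous Hg.
  by split=> // x; apply: cvgD; [exact: cf|exact: cg].
apply: (@CnS _ _ (fun i => 'D_(e i) f \+ 'D_(e i) g)).
- by move=> x; apply: cvgD; [exact: cf|exact: cg].
- by move=> i x; apply: is_deriveD; apply: (@CnS_derive n).
- by move=> i; apply: IHn; [case: Hf => _ /(_ i)[]|case: Hg => _ /(_ i)[]].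
Qed.

(** The derivatives of a product are sums of products, and [Cn] passes from
    order n+1 to order n, so induction on n closes. *)
Lemma CnM n f g : Cn n f -> Cn n g -> Cn n (f \* g).
Proof.
elim: n f g => [|n IHn] f g Hf Hg; have cf := Cn_continuous Hf;
  have cg := Cn_continuous Hg.
  by split=> // x; apply: cvgM; [exact: cf|exact: cg].
apply: (@CnS _ _ (fun i => (f \* 'D_(e i) g) \+ (g \* 'D_(e i) f))).
- by move=> x; apply: cvgM; [exact: cf|exact: cg].
- by move=> i x; apply: is_deriveM; apply: (@CnS_derive n).
- move=> i; apply: CnD; apply: IHn; try exact: CnW.
    by case: Hg => _ /(_ i)[].
  by case: Hf => _ /(_ i)[].
Qed.

Lemma CnV n f : (forall x, f x != 0) -> Cn n f -> Cn n (fun x => (f x)^-1).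
Proof.
move=> f0; elim: n => [|n IHn] Hf; have cf := Cn_continuous Hf.
  by split=> // x; apply: cvgV; [exact: f0|exact: cf].
have IH := IHn (CnW Hf).
apply: (@CnS _ _ (fun i => cst (-1) \* ((fun x => (f x)^-1) \*
                    ((fun x => (f x)^-1) \* 'D_(e i) f)))).
- by move=> x; apply: cvgV; [exact: f0|exact: cf].
- move=> i x; have d := @CnS_derive n f i x Hf.
  apply: DeriveDef; first exact: derivableV.
  by rewrite deriveV //= scaleNr expr2 invfM mulN1r mulrA.
- move=> i; do 2!(apply: CnM; first (exact: Cn_cst || exact: IH)).
  apply: CnM => //; by case: Hf => _ /(_ i)[].
Qed.

Lemma smooth_cst (a : R) : smooth (cst a).
Proof. by move=> n; exact: Cn_cst. Qed.

Lemma smoothD f g : smooth f -> smooth g -> smooth (f \+ g).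
Proof. by move=> Hf Hg n; exact: CnD. Qed.

Lemma smoothM f g : smooth f -> smooth g -> smooth (f \* g).
Proof. by move=> Hf Hg n; exact: CnM. Qed.

Lemma smoothV f : (forall x, f x != 0) -> smooth f ->
  smooth (fun x => (f x)^-1).
Proof. by move=> f0 Hf n; exact: CnV. Qed.

Lemma smooth_continuous f : smooth f -> continuous f.
Proof. by move=> /(_ 0); exact: Cn_continuous. Qed.

Lemma smooth_is_derive f i x : smooth f ->
  is_derive x (e i) f ('D_(e i) f x).
Proof. by move=> /(_ 1); exact: CnS_derive. Qed.

Lemma smooth_derive f i : smooth f -> smooth ('D_(e i) f).
Proof. by move=> Hf n; have [_ /(_ i)[]] := Hf n.+1. Qed.

Lemma smooth_sum (J : Type) (s : seq J) (F : J -> V -> R) :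
  (forall j, smooth (F j)) -> smooth (fun x => \sum_(j <- s) F j x).
Proof.
move=> HF; elim: s => [|j s IHs].
  under eq_fun do rewrite big_nil; exact: smooth_cst.
under eq_fun do rewrite big_cons; exact: smoothD.
Qed.

Lemma smooth_prod (J : Type) (s : seq J) (F : J -> V -> R) :
  (forall j, smooth (F j)) -> smooth (fun x => \prod_(j <- s) F j x).
Proof.
move=> HF; elim: s => [|j s IHs].
  under eq_fun do rewrite big_nil; exact: smooth_cst.
under eq_fun do rewrite big_cons; exact: smoothM.
Qed.

End Smoothness.

Section Smooth1.
Context {R : realType}.
Implicit Types (f g : R -> R).

(** Locked, so that comparing two derivatives never unfolds the limits that
    define them. *)
Definition D1 f : R -> R := locked ('D_1 f).

Lemma D1E f : D1 f = 'D_1 f.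
Proof. by rewrite /D1 -lock. Qed.

Definition smooth1 f := smooth (fun _ : unit => (1 : R)) f.

Lemma smooth1_is_derive f (x : R) : smooth1 f -> is_derive x 1 f (D1 f x).
Proof.
rewrite D1E => Hf.
exact: (@smooth_is_derive _ _ _ (fun _ : unit => 1 : R) f tt x Hf).
Qed.

Lemma smooth1_derive f : smooth1 f -> smooth1 (D1 f).
Proof. by rewrite D1E => Hf; exact: (@smooth_derive _ _ _ (fun _ : unit => 1 : R) f tt Hf). Qed.

Lemma Cn1S n f (df : R -> R) : (forall x : R, is_derive x 1 f (df x)) ->
  Cn (fun _ : unit => (1 : R)) n df -> Cn (fun _ : unit => (1 : R)) n.+1 f.
Proof.
move=> fdf Hdf; apply: (@CnS _ _ _ _ _ _ (fun=> df)) => // x.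
have [d _] := fdf x.
exact/differentiable_continuous/derivable1_diffP.
Qed.

Lemma smooth1_primitive f (df : R -> R) : (forall x : R, is_derive x 1 f (df x)) ->
  smooth1 df -> smooth1 f.
Proof.
move=> fdf Hdf; case=> [|n]; last exact: (Cn1S fdf).
by have := Cn1S fdf (Hdf 0%N) => -[].
Qed.

Lemma smooth1_id : smooth1 id.
Proof. by apply: (@smooth1_primitive _ (cst 1)) => //; exact: smooth_cst. Qed.

Lemma is_derive_affine f (a b x d : R) : is_derive (a * x + b) 1 f d ->
  is_derive x 1 (fun t => f (a * t + b)) (a * d).
Proof.
move=> fd.
have h : is_derive x (1 : R) (fun t : R => a * t + b) a.
  have := is_deriveD (is_deriveZ a (is_derive_id x (1 : R)))
    (is_derive_cst b x (1 : R)).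
  by rewrite addr0 [_ *: _]mulr1.
by have := @is_derive1_comp _ f (fun t => a * t + b) x d a fd h; rewrite mulrC.
Qed.

Lemma smooth1_affine f (a b : R) : smooth1 f -> smooth1 (fun t => f (a * t + b)).
Proof.
move=> Hf n; elim: n f Hf => [|n IHn] f Hf.
  split=> // x; apply: (@continuous_comp _ _ _ (fun t => a * t + b) f).
    by apply: cvgD; [apply: cvgMr; exact: cvg_id|exact: cvg_cst].
  exact: (smooth_continuous Hf).
apply: (@Cn1S _ _ (cst a \* (fun t => D1 f (a * t + b)))) => [x|].
  by apply: is_derive_affine; exact: smooth1_is_derive.
apply: CnM; first exact: Cn_cst.
by apply: (IHn (D1 f)); exact: smooth1_derive.
Qed.

Lemma derive_affine f (a b : R) : smooth1 f ->
  D1 (fun t => f (a * t + b)) = (fun t => a * D1 f (a * t + b)).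
Proof.
move=> Hf; apply/funext => x.
have h := smooth1_is_derive (a * x + b) Hf.
by rewrite [in LHS]D1E (@derive_val _ _ _ _ _ _ _ (is_derive_affine h)).
Qed.

Lemma is_derive_ext f g (x d d' : R) : is_derive x 1 f d' -> f =1 g -> d' = d ->
  is_derive x 1 g d.
Proof. by move=> h /funext <- <-. Qed.

Lemma derive_eq f (d : R -> R) : (forall x : R, is_derive x 1 f (d x)) ->
  D1 f = d.
Proof. by move=> fd; apply/funext => x; rewrite D1E (@derive_val _ _ _ _ _ _ _ (fd x)). Qed.

End Smooth1.

(** * Smooth steps with a controlled second derivative *)

Section Cutoffs.
Context {R : realType}.
Implicit Types (f g : R -> R) (n : nat) (t x y : R).

Lemma mean_value f (df : R -> R) (a b : R) :
  (forall x : R, is_derive x 1 f (df x)) -> a < b ->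
  exists c, [/\ a < c, c < b & f b - f a = df c * (b - a)].
Proof.
move=> fdf ab; have [|c] := @MVT _ f df a b ab (fun x _ => fdf x).
  apply: continuous_subspaceT => x; have [d _] := fdf x.
  exact/differentiable_continuous/derivable1_diffP.
by rewrite in_itv/= => /andP[ac cb] ?; exists c.
Qed.

(** The linear span of the functions exp(-1/t)/t^n is closed under differentiation,
    which gives the smoothness of exp(-1/t) at 0. *)
Definition flat n t : R := if 0 < t then t ^- n * expR (- t^-1) else 0.

(** The exponential series bounds exp(1/t) below by its term of degree n+2. *)
Lemma flat_bound n t : 0 < t -> flat n t <= n.+2`!%:R * t ^+ 2.
Proof.
move=> t0; rewrite /flat t0 expRN.
have ti0 : 0 < t^-1 by rewrite invr_gt0.
have h := expR_ge1Dxn n.+1 (ltW ti0).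
have {}h : t^-1 ^+ n.+2 / n.+2`!%:R <= expR t^-1.
  by apply: le_trans h; rewrite lerDr ler01.
have F0 : 0 < n.+2`!%:R :> R by rewrite ltr0n fact_gt0.
rewrite ler_pdivrMr ?expR_gt0//.
apply: le_trans (ler_wpM2l _ h); last first.
  by rewrite mulr_ge0 ?sqr_ge0// ltW.
rewrite exprVn (_ : _ * (_ / _) = t ^+ 2 * t ^- n.+2); last first.
  by field; rewrite expf_neq0 ?gt_eqF//= pnatr_eq0 -lt0n fact_gt0.
by rewrite -(addn2 n) exprD invfM mulrCA mulfV ?mulr1// expf_neq0// gt_eqF.
Qed.

Lemma is_derive_quadratic_bound f (C : R) : f 0 = 0 ->
  (forall t, (`|f t| : R) <= C * t ^+ 2) -> is_derive (0 : R) 1 f 0.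
Proof.
move=> f0 fC.
(* A positive constant is needed to divide by it. *)
wlog C0 : C fC / 0 < C.
  move=> /(_ (`|C| + 1)); apply; last by rewrite ltr_wpDl.
  move=> t; apply: le_trans (fC t) _; rewrite ler_wpM2r ?sqr_ge0//.
  by rewrite (le_trans (ler_norm C))// lerDl.
have h : (fun h => h^-1 *: ((f \o shift 0) (h *: 1) - f 0)) @ (0 : R)^' --> (0 : R).
  apply/cvgrPdist_le => eps eps0; near=> h.
  have hn0 : h != 0 by near: h; exact: nbhs_dnbhs_neq.
  rewrite /= /GRing.scale/= sub0r normrN f0 subr0 addr0 mulr1.
  rewrite normrM normfV ler_pdivrMl ?normr_gt0//.
  apply: (le_trans (fC h)); rewrite -real_normK ?num_real// expr2 mulrA mulrC.
  rewrite ler_wpM2l//.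
  rewrite mulrC -ler_pdivlMr//; near: h.
  by apply: dnbhs0_le; rewrite divr_gt0.
apply: DeriveDef; first by apply/cvg_ex; exists 0.
exact: (cvg_lim _ h).
Unshelve. all: by end_near. Qed.

Lemma is_derive_flat n x :
  is_derive x 1 (flat n) (flat n.+2 x - n%:R * flat n.+1 x).
Proof.
have [x0|x0|->] := ltgtP x 0.
- rewrite /flat !(ltNge 0) (ltW x0)/= mulr0 subr0.
  apply: (@near_eq_is_derive _ _ _ (cst 0)) => //.
  near=> t; rewrite ifF//; apply/negbTE; rewrite -leNgt; apply: ltW.
  by near: t; exact: lt_nbhsl.
- apply: (@near_eq_is_derive _ _ _ (fun t => (t ^+ n)^-1 * expR (- t^-1))).
    near=> t; rewrite /flat ifT//.
    by near: t; exact: lt_nbhsr.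
  have d1 : is_derive x 1 (fun t : R => t^-1) (- x ^- 2 *: 1).
    by apply: is_deriveV; rewrite gt_eqF.
  have d2 := @is_derive1_comp _ expR (fun t : R => - t^-1) x _ _
    (is_derive_expR (- x^-1)) (is_deriveN d1).
  have d3 : is_derive x 1 (fun t : R => (t ^+ n)^-1)
      (- (x ^+ n) ^- 2 *: (n%:R *: x ^+ n.-1 *: 1)).
    apply: (@is_deriveV _ (fun t : R => t ^+ n)).
      by rewrite expf_neq0// gt_eqF.
    rewrite -(exp_derive n x (1 : R)); exact/derivableP/exprn_derivable.
  apply: is_derive_eq (is_deriveM d3 d2) _.
  rewrite /flat x0 /= /GRing.scale/= !mulr1.
  have xn0 : x != 0 by rewrite gt_eqF.
  have xN0 : x ^+ n != 0 by rewrite expf_neq0.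
  case: n xN0 {d3} => [|n] xN0.
    by rewrite !expr0; field.
  by rewrite /= !exprS; field; rewrite xn0 expf_neq0.
- rewrite /flat ltxx mulr0 subr0.
  apply: (@is_derive_quadratic_bound _ n.+2`!%:R); rewrite ?ltxx//.
  move=> t; case: ifP => t0; last by rewrite normr0 mulr_ge0 ?sqr_ge0.
  rewrite ger0_norm; last by rewrite mulr_ge0 ?expR_ge0// invr_ge0 exprn_ge0// ltW.
  by have := flat_bound n t0; rewrite /flat t0.
Unshelve. all: by end_near. Qed.

Lemma smooth_flat n : smooth1 (flat n).
Proof.
move=> m; elim: m n => [|m IHm] n.
  split=> // x; have [d _] := is_derive_flat n x.
  exact/differentiable_continuous/derivable1_diffP.
apply: (Cn1S (is_derive_flat n)).
have -> : (fun x => flat n.+2 x - n%:R * flat n.+1 x) =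
    flat n.+2 \+ (cst (- n%:R) \* flat n.+1).
  by apply/funext => x /=; rewrite mulNr.
by apply: CnD => //; apply: CnM => //; exact: Cn_cst.
Qed.

Lemma flat0_gt0 t : 0 < t -> 0 < flat 0 t.
Proof. by move=> t0; rewrite /flat t0 expr0 invr1 mul1r expR_gt0. Qed.

Lemma flat0_eq0 t : t <= 0 -> flat 0 t = 0.
Proof. by rewrite /flat leNgt => /negbTE->. Qed.

Lemma flat0_ge0 t : 0 <= flat 0 t.
Proof. by have [/flat0_eq0->//|/flat0_gt0/ltW] := leP t 0. Qed.

Lemma smooth_step_exists : exists h : R -> R,
  [/\ smooth1 h, forall t, 0 <= h t <= 1, forall t, t <= 0 -> h t = 0 &
      forall t, 1 <= t -> h t = 1].
Proof.
pose d t : R := flat 0 t + flat 0 (- 1 * t + 1).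
have d0 t : 0 < d t.
  have [t0|t0] := leP t 0.
    by rewrite /d ltr_wpDl ?flat0_ge0// flat0_gt0//; lra.
  by rewrite /d ltr_wpDr ?flat0_ge0// flat0_gt0.
exists (fun t => flat 0 t * (d t)^-1); split.
- apply: smoothM; first exact: smooth_flat.
  apply: smoothV => [x|]; first by rewrite gt_eqF.
  by apply: smoothD; [exact: smooth_flat|exact: (smooth1_affine (-1) 1 (smooth_flat 0))].
- move=> t; apply/andP; split; first by rewrite divr_ge0 ?flat0_ge0// ltW.
  by rewrite ler_pdivrMr// mul1r lerDl flat0_ge0.
- by move=> t t0; rewrite flat0_eq0// mul0r.
- move=> t t1; rewrite /d [flat 0 (_ + _)]flat0_eq0; last lra.
  rewrite addr0 mulfV// gt_eqF// flat0_gt0//; lra.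
Qed.

(** The integral is started at -1 so that the differentiability of the primitive
    at points near 0 is covered by the interior case of the fundamental theorem. *)
Lemma primitive_exists f : continuous f -> (forall t, t <= 0 -> f t = 0) ->
  exists F : R -> R, (forall x, is_derive x 1 F (f x)) /\
    forall t, t <= 0 -> F t = 0.
Proof.
move=> cf f0.
pose F x := (\int[@lebesgue_measure R]_(t in [set` `[-1, x]%R]) f t)%R.
have F0 t : t <= 0 -> F t = 0.
  move=> t0; rewrite /F /Rintegral integral0_eq// => y /=.
  by rewrite in_itv/= => /andP[_ yt]; rewrite f0// (le_trans yt).
exists F; split=> // x; have [x1|x1] := leP x (-1/2).
  rewrite f0; last lra.
  apply: (@near_eq_is_derive _ _ _ (cst 0)) => //.
  near=> t; rewrite F0//; apply: ltW; near: t; apply: lt_nbhsl; lra.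
have [||||dF <-] := @continuous_FTC1_closed R f (-1) x (x + 1).
- lra.
- apply: continuous_compact_integrable; first exact: segment_compact.
  exact: continuous_subspaceT.
- lra.
- exact: cf.
by rewrite derive1E; exact/derivableP.
Unshelve. all: by end_near. Qed.

(** Let p be a plateau function on [0, 1] with values in [0, 1], P its primitive
    and Q the primitive of P.  Then J(s) = (Q(s) - Q(s-1)) / P(1) has second
    derivative (p(s) - p(s-1)) / P(1), which is at most 2 in absolute value since
    p = 1 on half of the interval; for s >= 2 the mean value theorem gives J = 1,
    because P is constant after 1. *)
Lemma controlled_step_exists : exists J : R -> R,
  [/\ smooth1 J,
      forall s, [/\ 0 <= J s <= 1, 0 <= D1 J s <= 1 &
                    (`|D1 (D1 J) s| : R) <= 2],
      forall s, s <= 0 -> [/\ J s = 0, D1 J s = 0 & D1 (D1 J) s = 0] &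
      forall s, 2 <= s -> [/\ J s = 1, D1 J s = 0 & D1 (D1 J) s = 0]].
Proof.
have [h [sh h01 h0 h1]] := smooth_step_exists.
pose p t := h (4 * t + 0) * h (- 4 * t + 4).
have sp : smooth1 p by apply: smoothM; exact: smooth1_affine.
have p01 t : 0 <= p t <= 1.
  have /andP[a0 a1] := h01 (4 * t + 0); have /andP[b0 b1] := h01 (- 4 * t + 4).
  by rewrite /p mulr_ge0//= mulr_ile1.
have p0 t : t <= 0 -> p t = 0.
  by move=> t0; rewrite /p h0 ?mul0r//; lra.
have p1 t : 1 <= t -> p t = 0.
  by move=> t1; rewrite /p [h (- 4 * _ + _)]h0 ?mulr0//; lra.
have pm t : 1/4 <= t -> t <= 3/4 -> p t = 1.
  by move=> t1 t2; rewrite /p !h1 ?mulr1//; lra.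
have [P [dP P0]] := primitive_exists (smooth_continuous sp) p0.
have sP : smooth1 P := smooth1_primitive dP sp.
have [Q [dQ Q0]] := primitive_exists (smooth_continuous sP) P0.
have sQ : smooth1 Q := smooth1_primitive dQ sP.
have Pmono a b : a <= b -> P a <= P b.
  rewrite le_eqVlt => /predU1P[->//|ab].
  have [c [_ _ E]] := mean_value dP ab.
  rewrite -subr_ge0 E mulr_ge0//; last lra.
  by have /andP[] := p01 c.
have P1 t : 1 <= t -> P t = P 1.
  rewrite le_eqVlt => /predU1P[->//|t1].
  have [c [c1 _ E]] := mean_value dP t1.
  by move: E; rewrite p1 ?mul0r ?ltW// => /eqP; rewrite subr_eq0 => /eqP.
have Pb t : 0 <= P t <= P 1.
  apply/andP; split.
    by have [t0|/ltW/Pmono] := leP t 0; [rewrite P0|rewrite P0].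
  by have [/ltW/P1->//|t1] := ltP 1 t; exact: Pmono.
have P1h : 1/2 <= P 1.
  have [|c [c1 c2 E]] := @mean_value P p (1/4) (3/4) dP; first lra.
  rewrite pm in E; [|lra|lra].
  have /andP[a0 _] := Pb (1/4); have /andP[_ b1] := Pb (3/4); lra.
pose a := (P 1)^-1.
have a0 : 0 < a by rewrite invr_gt0; lra.
have aP : a * P 1 = 1 by rewrite mulVf//; lra.
have a2 : a <= 2 by rewrite -(ler_pM2r (_ : 0 < P 1)) ?aP//; lra.
have shiftD f (df : R -> R) : (forall x, is_derive x 1 f (df x)) -> forall x : R,
    is_derive x 1 (fun t => a * (f t - f (t - 1))) (a * (df x - df (x - 1))).
  move=> fdf x.
  have d1 : is_derive x 1 (fun t => f (t - 1)) (df (x - 1)).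
    have := @is_derive_affine _ f 1 (-1) x (df (x - 1)); rewrite !mul1r.
    move=> /(_ (fdf _)).
    by under eq_fun do rewrite mul1r.
  exact: (is_deriveZ a (is_deriveB (fdf x) d1)).
pose J s := a * (Q s - Q (s - 1)).
have DJ : D1 J = fun s => a * (P s - P (s - 1))
  by apply: derive_eq; exact: shiftD.
have DDJ : D1 (D1 J) = fun s => a * (p s - p (s - 1)).
  by rewrite DJ; apply: derive_eq; exact: shiftD.
have JE s : exists2 c, s - 1 < c & J s = a * P c.
  have [c [c1 _ E]] := @mean_value Q P (s - 1) s dQ ltac:(lra).
  exists c => //; rewrite /J E; congr (_ * _); ring.
exists J; split.
- have -> : J = cst a \* (Q \+ (cst (-1) \* (fun s => Q (1 * s + -1)))).
    by apply/funext => s; rewrite /J /= mul1r mulN1r.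
  apply: smoothM; first exact: smooth_cst.
  apply: smoothD => //; apply: smoothM; first exact: smooth_cst.
  exact: smooth1_affine.
- move=> s; split.
  + have [c _ ->] := JE s; have /andP[c0 c1] := Pb c.
    apply/andP; split; first by rewrite mulr_ge0// ltW.
    by rewrite -aP ler_wpM2l// ltW.
  + have /andP[c0 c1] := Pb s; have /andP[d0 d1] := Pb (s - 1).
    have m : P (s - 1) <= P s by apply: Pmono; lra.
    rewrite DJ; apply/andP; split; first by rewrite mulr_ge0 ?subr_ge0// ltW.
    rewrite -[leRHS]aP ler_wpM2l ?(ltW a0)//; lra.
  + have /andP[c0 c1] := p01 s; have /andP[d0 d1] := p01 (s - 1).
    rewrite DDJ normrM gtr0_norm// -[leRHS]mulr1.
    apply: ler_pM => //; first exact: ltW.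
    by rewrite ler_norml; apply/andP; split; lra.
- move=> s s0; rewrite DDJ DJ /J !Q0 ?P0 ?p0 ?subrr ?mulr0//; lra.
- move=> s s2; split.
  + have [c c1 ->] := JE s; rewrite P1 ?aP//; lra.
  + rewrite DJ !P1 ?subrr ?mulr0//; lra.
  + rewrite DDJ !p1 ?subrr ?mulr0//; lra.
Qed.

End Cutoffs.

(** * One-dimensional profiles *)

Section Profiles.
Context {R : realType}.
Implicit Types (f g : R -> R) (t x y : R).

(** A plateau is 1 minus two steps, one on each side; a transition region of
    length 3/8 carries the second derivative bound (16/3)^2 * 2 <= 64. *)
Lemma eta_exists : exists eta : R -> R,
  [/\ smooth1 eta,
      forall y, 0 <= eta y <= 1 /\ (`|D1 (D1 eta) y| : R) <= 64,
      forall y, (`|D1 eta y| : R) <= 6,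
      forall y, (`|y| : R) <= 1/2 ->
        [/\ eta y = 1, D1 eta y = 0 & D1 (D1 eta) y = 0] &
      forall y, 7/8 <= `|y| ->
        [/\ eta y = 0, D1 eta y = 0 & D1 (D1 eta) y = 0]].
Proof.
have [J [sJ Jb J0 J1]] := @controlled_step_exists R.
pose u y : R := 16/3 * y + - (8/3); pose v y : R := - (16/3) * y + - (8/3).
pose eta y := 1 - J (u y) - J (v y).
have D f x : smooth1 f ->
    is_derive x 1 (fun y => f (u y)) (16/3 * D1 f (u x)) /\
    is_derive x 1 (fun y => f (v y)) (- (16/3) * D1 f (v x)).
  by move=> sf; split; apply: is_derive_affine; exact: smooth1_is_derive.
have sJ' := smooth1_derive sJ.
have d1 : D1 eta = fun y => 16/3 * (D1 J (v y) - D1 J (u y)).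
  apply: derive_eq => x; have [a b] := D J x sJ.
  apply: (is_derive_ext (is_deriveB (is_deriveB (is_derive_cst (1 : R) x (1 : R)) a) b)) => //.
  by ring.
have d2 : D1 (D1 eta) = fun y => - (16/3 * (16/3)) * (D1 (D1 J) (v y) + D1 (D1 J) (u y)).
  rewrite d1; apply: derive_eq => x; have [a b] := D (D1 J) x sJ'.
  apply: (is_derive_ext (is_deriveZ (16/3 : R) (is_deriveB b a))) => //.
  by rewrite /GRing.scale/=; ring.
exists eta; split.
- have -> : eta = cst 1 \+ (cst (-1) \* ((fun y => J (u y)) \+ (fun y => J (v y)))).
    by apply/funext => y; rewrite /eta /=; ring.
  apply: smoothD; first exact: smooth_cst.
  apply: smoothM; first exact: smooth_cst.
  by apply: smoothD; exact: smooth1_affine.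
- move=> y; rewrite d2.
  have [/andP[a0 a1] _ a2] := Jb (u y); have [/andP[b0 b1] _ b2] := Jb (v y).
  have /andP[{}a2 a3] : -2 <= D1 (D1 J) (u y) <= 2 by rewrite -ler_norml.
  have /andP[{}b2 b3] : -2 <= D1 (D1 J) (v y) <= 2 by rewrite -ler_norml.
  have [uy|uy] := leP (u y) 0.
    have [e1 _ e2] := J0 (u y) uy; rewrite /eta e1 e2.
    by split; [|rewrite ler_norml]; apply/andP; split; lra.
  have [|e1 _ e2] := J0 (v y); first by rewrite /v; rewrite /u in uy; lra.
  rewrite /eta e1 e2.
  by split; [|rewrite ler_norml]; apply/andP; split; lra.
- move=> y; rewrite d1.
  have [_ /andP[a0 a1] _] := Jb (u y); have [_ /andP[b0 b1] _] := Jb (v y).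
  by rewrite ler_norml; apply/andP; split; lra.
- move=> y; rewrite ler_norml => /andP[y0 y1]; rewrite d2 d1 /eta.
  have [|e1 e2 e3] := J0 (u y); first by rewrite /u; lra.
  have [|f1 f2 f3] := J0 (v y); first by rewrite /v; lra.
  by rewrite e1 e2 e3 f1 f2 f3; split; ring.
- move=> y; rewrite ler_normr d2 d1 /eta => /orP[yy|yy].
    have [|e1 e2 e3] := J1 (u y); first by rewrite /u; lra.
    have [|f1 f2 f3] := J0 (v y); first by rewrite /v; lra.
    by rewrite e1 e2 e3 f1 f2 f3; split; ring.
  have [|e1 e2 e3] := J0 (u y); first by rewrite /u; lra.
  have [|f1 f2 f3] := J1 (v y); first by rewrite /v; lra.
  by rewrite e1 e2 e3 f1 f2 f3; split; ring.
Qed.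

(** A parabola near the origin, cut off by a dilated plateau. *)
Lemma psi_exists : exists psi : R -> R,
  [/\ smooth1 psi,
      forall y, 0 <= psi y <= 2 /\ (`|D1 (D1 psi) y| : R) <= 64,
      forall y, (`|y| : R) <= 1 ->
        [/\ psi y = y ^+ 2 / 2, D1 psi y = y & D1 (D1 psi) y = 1] &
      forall y, 7/4 <= `|y| -> psi y = 0].
Proof.
have [eta [se eb e' e1 e0]] := eta_exists.
pose h f y := f (1/2 * y + 0 : R) : R.
pose psi y := h eta y * (y * y / 2).
have D f x : smooth1 f -> is_derive x 1 (h f) (1/2 * h (D1 f) x).
  by move=> sf; apply: is_derive_affine; exact: smooth1_is_derive.
have se' := smooth1_derive se.
have dx x : is_derive x (1 : R) (fun y : R => y * y / 2) x.
  have := is_deriveZ (2^-1 : R) (is_deriveM (is_derive_id x (1 : R)) (is_derive_id x (1 : R))).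
  have -> : 2^-1 *: (x *: 1 + x *: 1) = x by rewrite /GRing.scale/=; field.
  rewrite [X in is_derive _ _ X](_ : _ = fun y : R => y * y / 2)//.
  by apply/funext => y /=; rewrite /GRing.scale/= mulrC.
have d1 : D1 psi = fun y => h eta y * y + h (D1 eta) y * (1/2 * (y * y / 2)).
  apply: derive_eq => x.
  apply: (is_derive_ext (is_deriveM (D eta x se) (dx x))) => //.
  by rewrite /GRing.scale/=; ring.
have d2 : D1 (D1 psi) =
    fun y => h eta y + h (D1 eta) y * y + h (D1 (D1 eta)) y * (y * y / 8).
  rewrite d1; apply: derive_eq => x.
  apply: (is_derive_ext (is_deriveD
    (is_deriveM (D eta x se) (is_derive_id x (1 : R)))
    (is_deriveM (D _ x se') (is_deriveZ (1/2 : R) (dx x))))) => //.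
  by do 2 rewrite /GRing.scale/=; field.
have hN y : `|1/2 * y + 0| = 1/2 * `|y| by rewrite addr0 normrM ger0_norm//; lra.
exists psi; split.
- apply: smoothM; first exact: smooth1_affine.
  have -> : (fun y : R => y * y / 2) = (cst (1/2) \* (id \* id)).
    by apply/funext => y /=; field.
  apply: smoothM; first exact: smooth_cst.
  by apply: smoothM; exact: smooth1_id.
- move=> y; rewrite d2 /psi /h.
  have [yb|yb] := leP (7/4) `|y|.
    have [|-> -> ->] := e0 (1/2 * y + 0); first by rewrite hN; lra.
    by rewrite !mul0r !addr0 normr0; split; [apply/andP; split|]; lra.
  have y2 : y * y <= 49/16.
    rewrite -[y * y]ger0_norm ?sqr_ge0// normrM.
    rewrite (_ : 49/16 = 7/4 * (7/4)); last by field.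
    by apply: ler_pM => //; exact: ltW.
  have y20 : 0 <= y * y by exact: sqr_ge0.
  have [/andP[a0 a1] a2] := eb (1/2 * y + 0).
  split.
    apply/andP; split; first by apply: mulr_ge0 => //; lra.
    rewrite -[leRHS]mul1r.
    by apply: ler_pM => //; lra.
  apply: le_trans (ler_normD _ _) _.
  have t1 : (`|eta (1/2 * y + 0) + D1 eta (1/2 * y + 0) * y| : R) <= 1 + 6 * (7/4).
    apply: le_trans (ler_normD _ _) _; apply: lerD; first by rewrite ger0_norm.
    by rewrite normrM; apply: ler_pM => //; exact: ltW.
  have t2 : (`|D1 (D1 eta) (1/2 * y + 0) * (y * y / 8)| : R) <= 64 * (49/128).
    rewrite normrM; apply: ler_pM => //.
    by rewrite ger0_norm; lra.
  by apply: le_trans (lerD t1 t2) _; lra.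
- move=> y y1; have [|a b c] := e1 (1/2 * y + 0); first by rewrite hN; lra.
  by rewrite d2 d1 /psi /h a b c; split; field.
- move=> y y1; have [|a _ _] := e0 (1/2 * y + 0); first by rewrite hN; lra.
  by rewrite /psi /h a mul0r.
Qed.

Lemma zeta_exists : exists zeta : R -> R,
  [/\ smooth1 zeta, forall y, 0 <= zeta y <= 1,
      forall y, (`|y| : R) <= 7/8 -> zeta y = 1 &
      forall y, 1 < `|y| -> zeta y = 0].
Proof.
have [h [sh h01 h0 h1]] := @smooth_step_exists R.
exists (fun y => h (8 * y + 8) * h (- 8 * y + 8)); split.
- by apply: smoothM; exact: smooth1_affine.
- move=> y; have /andP[a0 a1] := h01 (8 * y + 8).
  have /andP[b0 b1] := h01 (- 8 * y + 8).
  by rewrite mulr_ge0//= mulr_ile1.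
- by move=> y; rewrite ler_norml => /andP[y0 y1]; rewrite !h1 ?mulr1//; lra.
- move=> y; rewrite ltr_normr => /orP[y1|y1].
    by rewrite [h (- 8 * _ + _)]h0 ?mulr0//; lra.
  by rewrite h0 ?mul0r//; lra.
Qed.

(** The inequality is strict so that the property passes to derivatives, the
    vanishing set being open. *)
Definition vanish r f := forall y, r < `|y| -> f y = 0.

Lemma vanish_D1 r f : vanish r f -> vanish r (D1 f).
Proof.
move=> f0 y ry; rewrite D1E.
have : \forall x \near y, f x = cst 0 x.
  have h : (fun x : R => `|x|) @ y --> `|y| by apply: cvg_norm; exact: cvg_id.
  near=> x; apply: f0; near: x; exact: (cvgr_gt _ h).
by move=> /(@near_eq_derive _ _ _ f (cst 0)) ->; rewrite derive_cst.
Unshelve. all: by end_near. Qed.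

End Profiles.

(** * Periodic arrangements of bumps and tensor products *)

Section Periodize.
Context {R : realType}.
Variables (k : R) (K : nat).
Hypotheses (k32 : (32 : R) <= k) (kK : K%:R = k / 16).
Implicit Types (f g : R -> R) (t y : R) (j : 'I_K).

(** The K = k/16 sites have spacing 5/k, more than the width 4/k of a bump, and
    all bumps stay inside [-7/32, 7/32]. *)
Definition site (j : nat) : R := 5 * j%:R / k - 1/8.

Definition periodize f t : R := \sum_(j < K) f (k * t + - (k * site j)).

(** The rescaled coordinate relative to the site whose bump covers t.  The value 3
    stands for points covered by no bump: all profiles vanish there, so
    [periodize f t = f (local_coord t)] holds without case distinction. *)
Definition local_coord t : R :=
  if [pick j : 'I_K | (`|k * t + - (k * site j)| : R) <= (2 : R)] is Some j
  then k * t + - (k * site j) else 3.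

Let k_gt0 : 0 < k. Proof. by apply: lt_le_trans k32. Qed.

Lemma site_inj t (i j : nat) : (`|k * t + - (k * site i)| : R) <= (2 : R) ->
  (`|k * t + - (k * site j)| : R) <= (2 : R) -> i = j.
Proof.
have E n : k * site n = 5 * n%:R - k / 8.
  by rewrite /site; field; rewrite gt_eqF.
rewrite !E !ler_norml => /andP[a1 a2] /andP[b1 b2].
have [ij|ij|//] := ltngtP i j.
  have : (i%:R + 1 <= j%:R :> R) by rewrite natr1 ler_nat.
  by move=> ?; exfalso; lra.
have : (j%:R + 1 <= i%:R :> R) by rewrite natr1 ler_nat.
by move=> ?; exfalso; lra.
Qed.

Lemma local_coord_site (j : 'I_K) t : (`|k * t + - (k * site j)| : R) <= (2 : R) ->
  local_coord t = k * t + - (k * site j).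
Proof.
move=> tj; rewrite /local_coord; case: pickP => [i ti|/(_ j)]; last by rewrite tj.
by rewrite (site_inj ti tj).
Qed.

Lemma local_coordP t :
  (exists2 j : 'I_K, (`|k * t + - (k * site j)| : R) <= (2 : R) &
     local_coord t = k * t + - (k * site j)) \/
  ((forall j : 'I_K, (2 : R) < `|k * t + - (k * site j)|) /\ local_coord t = 3).
Proof.
rewrite /local_coord; case: pickP => [j tj|h]; first by left; exists j.
by right; split=> // j; rewrite ltNge h.
Qed.

Lemma site_near (j : 'I_K) t : (`|k * t + - (k * site j)| : R) <= (2 : R) ->
  (`|t| : R) <= (7/32 : R).
Proof.
have E : k * site j = 5 * j%:R - k / 8.
  by rewrite /site; field; rewrite gt_eqF.
rewrite E !ler_norml => /andP[a1 a2].
have jK : (j%:R + 1 <= k / 16 :> R) by rewrite -kK natr1 ler_nat.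
have j0 : (0 <= j%:R :> R) by [].
have kb := k32; have t1 : k * t <= k * (7/32) by lra.
have t2 : - (k * (7/32)) <= k * t by lra.
by rewrite -(ler_pM2l k_gt0) mulrN t2 -(ler_pM2l k_gt0) t1.
Qed.

Lemma local_coord_far t : (7/32 : R) < `|t| -> local_coord t = 3.
Proof.
move=> t0; have [[j tj _]|[]//] := local_coordP t.
by move: t0; rewrite ltNge (site_near tj).
Qed.

Lemma periodizeE f t : vanish 2 f -> periodize f t = f (local_coord t).
Proof.
move=> f0; have [[j tj ->]|[h ->]] := local_coordP t.
  rewrite /periodize (bigD1 j)//= big1 ?addr0// => i ij; apply: f0.
  rewrite ltNge; apply: contra ij => ti.
  by apply/eqP/val_inj; exact: site_inj ti tj.
rewrite /periodize big1 => [|j _]; last exact: f0.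
by rewrite f0// ger0_norm//; lra.
Qed.

Lemma smooth_periodize f : smooth1 f -> smooth1 (periodize f).
Proof. by move=> sf; apply: smooth_sum => j; exact: smooth1_affine. Qed.

Lemma D1_periodize f : smooth1 f ->
  D1 (periodize f) = fun t => k * periodize (D1 f) t.
Proof.
move=> sf; apply: derive_eq => x.
have h : is_derive x 1 (\sum_(j < K) (fun t => f (k * t + - (k * site j))))
    (\sum_(j < K) k * D1 f (k * x + - (k * site j))).
  apply: is_derive_sum => j; apply: is_derive_affine.
  exact: smooth1_is_derive.
apply: (is_derive_ext h); last by rewrite mulr_sumr.
by move=> t; rewrite fct_sumE.
Qed.

End Periodize.

Section Bumps.
Context {R : realType}.

Record bumpfn := Bump {
  bump_fun :> R -> R;
  bump_smooth : smooth1 bump_fun;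
  bump_vanish : vanish 1 bump_fun }.

Definition bump_D1 (g : bumpfn) : bumpfn :=
  Bump (smooth1_derive (bump_smooth g)) (vanish_D1 (bump_vanish g)).

Lemma scale_vanish (c r s : R) (f : R -> R) : 0 < c -> s <= c * r ->
  vanish s f -> vanish r (fun t => f (c * t + 0)).
Proof.
move=> c0 cr f0 t rt; apply: f0; rewrite addr0 normrM gtr0_norm//.
by apply: le_lt_trans cr _; rewrite ltr_pM2l.
Qed.

End Bumps.

Section Tensors.
Context {R : realType}.
Implicit Types (x : 'rV[R]_3) (i j : 'I_3).

(** Functions of three variables are kept as lists of weighted products of
    one-dimensional bumps, because differentiation, rotation of the axes and
    periodic repetition all act factor by factor. *)
Definition tensor := seq (R * ('I_3 -> @bumpfn R)).
Implicit Types T : tensor.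

Definition dir i : 'rV[R]_3 := delta_mx 0 i.

Definition ev T x : R := \sum_(t <- T) t.1 * \prod_i t.2 i (x 0 i).

Definition dT i T : tensor :=
  [seq (t.1, fun j => if j == i then bump_D1 (t.2 j) else t.2 j) | t <- T].

Definition smooth3 (f : 'rV[R]_3 -> R) := smooth dir f.

Lemma continuous_coord i : continuous (fun x : 'rV[R]_3 => x 0 i).
Proof. exact: coord_continuous. Qed.

Lemma dirE i (h : R) x j : (h *: dir i + x) 0 j = h * (j == i)%:R + x 0 j.
Proof. by rewrite !mxE eqxx. Qed.

Lemma is_derive_line (f : 'rV[R]_3 -> R) (g : R -> R) i x (d : R) :
  (forall h : R, f (h *: dir i + x) = g h) -> is_derive (0 : R) 1 g d ->
  is_derive x (dir i) f d.
Proof.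
move=> fg [d1 d2].
have E : (fun h : R => h^-1 *: ((f \o shift x) (h *: dir i) - f x)) =
    (fun h : R => h^-1 *: ((g \o shift 0) (h *: 1) - g 0)).
  apply/funext => h /=; rewrite fg addr0 [h *: 1]mulr1.
  by rewrite -[x in f x]add0r -(scale0r (dir i)) fg.
by apply: DeriveDef; [rewrite /derivable E|rewrite -d2 /derive E].
Qed.

Lemma is_derive_coord i j (f : R -> R) x : smooth1 f ->
  is_derive x (dir j) (fun y : 'rV[R]_3 => f (y 0 i))
    (if i == j then D1 f (x 0 i) else 0).
Proof.
move=> sf.
apply: (@is_derive_line _ (fun h => f ((i == j)%:R * h + x 0 i))) => [h|].
  by rewrite dirE mulrC.
apply: (is_derive_ext (is_derive_affine (smooth1_is_derive _ sf))) => //.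
by rewrite mulr0 add0r; case: eqP; rewrite ?mul1r ?mul0r.
Qed.

Lemma smooth3_coord i (f : R -> R) : smooth1 f ->
  smooth3 (fun y => f (y 0 i)).
Proof.
move=> sf n; elim: n f sf => [|n IHn] f sf.
  split=> // x; apply: (@continuous_comp _ _ _ (fun y : 'rV[R]_3 => y 0 i) f).
    exact: continuous_coord.
  exact: (smooth_continuous sf).
apply: (@CnS R _ _ dir n (fun y : 'rV[R]_3 => f (y 0 i))
  (fun j (y : 'rV[R]_3) => if i == j then D1 f (y 0 i) else 0)) => [||j].
- move=> x; apply: (@continuous_comp _ _ _ (fun y : 'rV[R]_3 => y 0 i) f).
    exact: continuous_coord.
  exact: (smooth_continuous sf).
- by move=> j x; exact: is_derive_coord.
- case: (i == j); last exact: Cn_cst.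
  by apply: IHn; exact: smooth1_derive.
Qed.

Lemma smooth3_ev T : smooth3 (ev T).
Proof.
apply: smooth_sum => t; apply: smoothM; first exact: smooth_cst.
by apply: smooth_prod => i; apply: smooth3_coord; exact: bump_smooth.
Qed.

Lemma is_derive_ev T i x : is_derive x (dir i) (ev T) (ev (dT i T) x).
Proof.
have term (t : R * ('I_3 -> @bumpfn R)) : is_derive x (dir i)
    (fun y => t.1 * \prod_j t.2 j (y 0 j))
    (t.1 * \prod_j (if j == i then bump_D1 (t.2 j) else t.2 j) (x 0 j)).
  pose c := \prod_(j | j != i) t.2 j (x 0 j).
  apply: (@is_derive_line _ (fun h => t.1 * (t.2 i (1 * h + x 0 i) * c))) => [h|].
    rewrite (bigD1 i)//= dirE eqxx mulr1 mul1r; congr (_ * (_ * _)).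
    by apply: eq_bigr => j ji; rewrite dirE (negbTE ji) mulr0 add0r.
  have h := is_derive_affine (smooth1_is_derive (1 * 0 + x 0 i)
    (bump_smooth (t.2 i))).
  apply: (is_derive_ext (is_deriveZ t.1 (is_deriveM h (is_derive_cst c (0 : R) (1 : R))))) => //.
  rewrite (bigD1 i)//= eqxx /GRing.scale/= !mulr0 !add0r !mul1r; congr (_ * _).
  rewrite mulrC; congr (_ * _); apply: eq_bigr => j ji.
  by rewrite (negbTE ji).
elim: T => [|t T IHT].
  rewrite /ev /= big_nil; under eq_fun do rewrite big_nil.
  exact: is_derive_cst.
rewrite /ev /= big_cons; under eq_fun do rewrite big_cons.
exact: (is_deriveD (term t) IHT).
Qed.

End Tensors.

(** * Ellipticity of V x M in the three regions *)

Section BlockArithmetic.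
Context {R : realType}.
Implicit Types (x y z a b c : R).

Lemma normM_le a b x y : (`|a| : R) <= x -> (`|b| : R) <= y ->
  (`|a * b| : R) <= x * y.
Proof. by move=> ax bY; rewrite normrM; apply: ler_pM. Qed.

Lemma norm_bounds a x : (`|a| : R) <= x -> - x <= a /\ a <= x.
Proof. by rewrite ler_norml => /andP[]. Qed.

Lemma unit_norm a : 0 <= a <= 1 -> (`|a| : R) <= 1.
Proof. by move=> /andP[a0 a1]; rewrite ger0_norm. Qed.

Variables (L h g sg b a : R).
Hypotheses (h1 : 32 * (32 * h) = 1) (g1 : 16 * (16 * g) = h)
  (Lh : 2 <= L * h) (sgh : sg * h = 8 * 64) (bL : b * L = 2) (ah : a * h = 4).

(** The range of the coefficients: L is the gain of the Hessian per generation, sg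
    the largest weight in V. *)
Definition in_range c : Prop := 1 <= c /\ c <= 2 * (sg * L).

Lemma curv2_gt0 : 0 < h.
Proof. by have := h1 => h1'; lra. Qed.

Lemma gain_big : 32 * 64 <= L.
Proof.
have h0 := curv2_gt0; have Lh' := Lh; have h1' := h1.
by rewrite -(ler_pM2r h0); lra.
Qed.

Lemma sg_eq : sg = 8 * 64 * (32 * 32).
Proof.
have h0 := curv2_gt0; have h1' := h1; apply: (mulIf (lt0r_neq0 h0)).
by rewrite sgh; lra.
Qed.

Lemma b_small : 0 < b /\ 32 * (32 * b) <= 1.
Proof.
have L1 := gain_big; have L0 : 0 < L by lra.
have b0 : 0 < b by rewrite -(pmulr_lgt0 _ L0) bL.
split=> //; rewrite -(ler_pM2r L0); have bL' := bL; lra.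
Qed.

Lemma sgL_eq : sg * L = 8 * 64 * (32 * 32) * L.
Proof. by rewrite sg_eq. Qed.

(** Indices are taken modulo 3. *)
Definition crossp (V M : 'I_3 -> R) (i : 'I_3) : R :=
  V (i + 1) * M (i + 1 + 1) - V (i + 1 + 1) * M (i + 1).

(** Outside the slabs the protected pair is M0 < 0 < M2 while M1 is only bounded by
    a multiple of L.  The weight sg L beats 2 |M1| because M2 >= h/2 and
    sg h = 512. *)
Lemma range_outer (M0 M1 M2 : R) : -1 - h/2 <= M0 -> M0 <= -1 + h/2 ->
  h/2 <= M2 -> M2 <= 3 * h/2 -> - (65 * L) <= M1 -> M1 <= 65 * L ->
  [/\ in_range (sg * L * M2 - (-2) * M1),
      in_range ((-2) * M0 - (-2) * M2) &
      in_range ((-2) * M1 - sg * L * M0)].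
Proof.
move=> a1 a2 c1 c2 b1 b2.
have h0 := curv2_gt0; have L1 := gain_big; have h1' := h1; have P := sgL_eq.
have P0 : 0 <= sg * L by rewrite P; lra.
have Ph : sg * L * h = 8 * 64 * L by rewrite mulrAC sgh.
have d1 := ler_wpM2l P0 c1; have d2 := ler_wpM2l P0 c2.
have e1 := ler_wpM2l P0 a1; have e2 := ler_wpM2l P0 a2.
by rewrite /in_range; split; split; lra.
Qed.

(** On the slabs the protected pair is M1 < 0 < M2, with M1 of order L and M2 of
    order h. *)
Lemma range_strip (M0 M1 M2 : R) : - (L/8) <= M0 -> M0 <= L/8 ->
  h/2 <= M2 -> M2 <= 3 * h/2 -> - (3 * L/2) <= M1 -> M1 <= - (L/2) ->
  [/\ in_range (b * M2 - b * M1),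
      in_range (b * M0 - (- a) * M2) &
      in_range ((- a) * M1 - b * M0)].
Proof.
move=> a1 a2 c1 c2 b1 b2.
have h0 := curv2_gt0; have L1 := gain_big; have h1' := h1; have P := sgL_eq.
have [b0 b3] := b_small; have bL' := bL; have ah' := ah.
have aE : a = 4 * (32 * 32).
  by apply: (mulIf (lt0r_neq0 h0)); rewrite ah; lra.
have e1 := ler_wpM2l (ltW b0) a1; have e2 := ler_wpM2l (ltW b0) a2.
have f1 := ler_wpM2l (ltW b0) b1; have f2 := ler_wpM2l (ltW b0) b2.
have g1' := ler_wpM2l (ltW b0) c1; have g2 := ler_wpM2l (ltW b0) c2.
have bh : b * h <= 1 by rewrite -[leRHS]mulr1; apply: ler_pM; lra.
have bh0 : 0 <= b * h by rewrite mulr_ge0// ltW.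
by rewrite /in_range P aE; split; split; lra.
Qed.

(** On the rods the protected pair is M1 < 0 < M0, both of order L.  The weights are
    those of [range_outer] divided by L, with the axes rotated; this is what
    makes the coefficients match on the small cubes. *)
Lemma range_rod (M0 M1 M2 : R) : L * h/2 <= M0 -> M0 <= 3 * (L * h)/2 ->
  - L <= M2 -> M2 <= L -> - (3 * L/2) <= M1 -> M1 <= - (L/2) ->
  [/\ in_range ((- b) * M2 - sg * M1),
      in_range (sg * M0 - (- b) * M2) &
      in_range ((- b) * M1 - (- b) * M0)].
Proof.
move=> a1 a2 c1 c2 b1 b2.
have h0 := curv2_gt0; have L1 := gain_big; have h1' := h1; have P := sgL_eq.
have [b0 b3] := b_small; have bL' := bL; have sE := sg_eq.
have e1 := ler_wpM2l (ltW b0) a1; have e2 := ler_wpM2l (ltW b0) a2.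
have f1 := ler_wpM2l (ltW b0) b1; have f2 := ler_wpM2l (ltW b0) b2.
have g1' := ler_wpM2l (ltW b0) c1; have g2 := ler_wpM2l (ltW b0) c2.
have hE : h = (32 * 32)^-1 by apply: (mulfI (_ : (32 * 32 : R) != 0)); lra.
have bLh : b * (L * h) = 2 * h by rewrite mulrA bL.
have Lh2 : L * h = L / (32 * 32) by rewrite hE.
have Lh' := Lh.
by rewrite /in_range P sE; split; split; lra.
Qed.

Lemma in_range_convex (w1 w2 w3 : R) x y z :
  0 <= w1 -> 0 <= w2 -> 0 <= w3 -> w1 + w2 + w3 = 1 ->
  (w1 != 0 -> in_range x) -> (w2 != 0 -> in_range y) ->
  (w3 != 0 -> in_range z) -> in_range (w1 * x + w2 * y + w3 * z).
Proof.
move=> p1 p2 p3 p123 X Y Z.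
have key w c : 0 <= w -> (w != 0 -> in_range c) ->
    w <= w * c /\ w * c <= w * (2 * (sg * L)).
  have [->|w0] := eqVneq w 0; first by rewrite !mul0r.
  move=> w1' /(_ isT)[c1 c2]; split; last exact: ler_wpM2l.
  by rewrite -[leLHS]mulr1; exact: ler_wpM2l.
have [x1 x2] := key _ _ p1 X; have [y1 y2] := key _ _ p2 Y.
have [z1 z2] := key _ _ p3 Z.
split; first lra.
have -> : 2 * (sg * L) = w1 * (2 * (sg * L)) + w2 * (2 * (sg * L))
    + w3 * (2 * (sg * L)) by rewrite -!mulrDl p123 mul1r.
lra.
Qed.

End BlockArithmetic.

(** * The building block at one point *)

Section BlockRegions.
Context {R : realType}.
Variables (e e2 s s2 z : R -> R).
Hypotheses (e01 : forall y, 0 <= e y <= 1)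
  (e2b : forall y, (`|e2 y| : R) <= 64)
  (e_in : forall y, (`|y| : R) <= 1/2 -> e y = 1 /\ e2 y = 0)
  (e_out : forall y, 7/8 <= `|y| -> e y = 0 /\ e2 y = 0)
  (s02 : forall y, 0 <= s y <= 2) (s2b : forall y, (`|s2 y| : R) <= 64)
  (s_in : forall y, (`|y| : R) <= 1 -> s2 y = 1)
  (s_out : forall y, 7/4 < `|y| -> s y = 0 /\ s2 y = 0)
  (z01 : forall y, 0 <= z y <= 1)
  (z_in : forall y, (`|y| : R) <= 7/8 -> z y = 1)
  (z_out : forall y, 1 < `|y| -> z y = 0).
Variables (L h g sg b a : R).
Hypotheses (h1 : 32 * (32 * h) = 1) (g1 : 16 * (16 * g) = h)
  (Lh : 2 <= L * h) (sgh : sg * h = 8 * 64) (bL : b * L = 2) (ah : a * h = 4).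
Variables (kk p a1 a2 a3 : R).
Hypotheses (hkk : h * kk = 8 * 64 * L) (p0 : 0 <= p) (ph : p <= h)
  (a1E : a1 * kk = L + p) (a2E : a2 * kk = L * h + 1)
  (a3E : a3 * kk = L * g - h).
Variables (x0 x2 y0 y1 y2 : R).
Hypotheses (c0 : (`|y0| : R) <= 2 /\ (`|x0| : R) <= 7/32 \/ y0 = 3)
  (c2 : (`|y2| : R) <= 2 /\ (`|x2| : R) <= 7/32 \/ y2 = 3).

(** The diagonal Hessian of the block, written with the coordinates x0, x2 and the
    local coordinates y0, y1, y2, which are treated as independent numbers; the
    functions e2 and s2 stand for the second derivatives of e and s. *)
Definition hess0 : R := -1 - a1 * (e2 x0 * (s y1 * e x2))
  + a2 * kk * (s2 y0 * (e y1 * e (2 * x2)))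
  + a3 * kk * (e2 y0 * (e (2 * y1) * s y2)).
Definition hess1 : R := p - a1 * kk * (e x0 * (s2 y1 * e x2))
  + a2 * kk * (s y0 * (e2 y1 * e (2 * x2)))
  + a3 * kk * (4 * (e y0 * (e2 (2 * y1) * s y2))).
Definition hess2 : R := h - a1 * (e x0 * (s y1 * e2 x2))
  + a2 * (4 * (s y0 * (e y1 * e2 (2 * x2))))
  + a3 * kk * (e y0 * (e (2 * y1) * s2 y2)).

(** Switches from the outer choice of V to the slab choice.  No derivative of the
    switches enters the estimates, so their transition can be placed in the thin
    layer between the region where the profiles are constant or quadratic and
    the support of the next oscillation. *)
Definition chi1 : R := z (2 * x0) * (z y1 * z (2 * x2)).
Definition chi2 : R := z y0 * (z (2 * y1) * z (4 * x2)).

(** The first oscillation has amplitude about L/k^2, small against the curvature h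
    in the protected directions; the second one is smaller by a factor h. *)
Lemma amplitudes : [/\ 0 <= a1, 32 * (8 * a1) <= h, 0 <= a2,
  32 * (64 * a2) <= h & 0 <= a3].
Proof.
have h0 := curv2_gt0 h1; have L1 := gain_big h1 Lh.
have kk0 : 0 < kk by rewrite -(pmulr_rgt0 _ h0) hkk; lra.
have E := hkk; have h1' := h1; have g1' := g1; have Lh' := Lh.
have P0 := p0; have Ph := ph; have E1 := a1E; have E2 := a2E; have E3 := a3E.
have Lg : 16 * (16 * (L * g)) = L * h by rewrite -g1; ring.
have Lh0 : 0 <= L * h - 2 by lra.
have Lh2 : 32 * (32 * (L * h)) = L by rewrite -[RHS](mulr1 L) -[X in _ = _ * X]h1; ring.
have hL1 : L * h <= L by rewrite -[leRHS]mulr1 ler_pM2l; lra.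
split.
- by rewrite -(ler_pM2r kk0) mul0r a1E; lra.
- by rewrite -(ler_pM2r kk0) -!mulrA a1E hkk; lra.
- by rewrite -(ler_pM2r kk0) mul0r a2E; lra.
- by rewrite -(ler_pM2r kk0) -!mulrA a2E hkk; lra.
- by rewrite -(ler_pM2r kk0) mul0r a3E; lra.
Qed.

Lemma norm2 y : (`|2 * y| : R) = 2 * `|y|.
Proof. by rewrite normrM ger0_norm. Qed.

Lemma norm4 y : (`|4 * y| : R) = 4 * `|y|.
Proof. by rewrite normrM ger0_norm. Qed.

Let s2n y : (`|s y| : R) <= 2.
Proof. by have /andP[u v] := s02 y; rewrite ger0_norm. Qed.

Let e1n y : (`|e y| : R) <= 1. Proof. exact: unit_norm. Qed.

Let y0_case : 7/16 < `|x0| -> y0 = 3.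
Proof. by case: c0 => // -[_ u] v; exfalso; lra. Qed.

Let y2_case : 7/32 < `|x2| -> y2 = 3.
Proof. by case: c2 => // -[_ u] v; exfalso; lra. Qed.

Let norm3 : (`|3 : R| : R) = 3. Proof. by rewrite ger0_norm. Qed.

Let s3 : s 3 = 0 /\ s2 3 = 0.
Proof. by apply: s_out; rewrite norm3; lra. Qed.

Let e3 : e 3 = 0 /\ e2 3 = 0.
Proof. by apply: e_out; rewrite norm3; lra. Qed.

Let B1 (u v w : R) : (`|u| : R) <= 64 -> (`|v| : R) <= 2 -> (`|w| : R) <= 1 ->
  - (h/2) <= a1 * (u * (v * w)) /\ a1 * (u * (v * w)) <= h/2.
Proof.
move=> U V W; apply: norm_bounds.
have [q0 q1 _ _ _] := amplitudes.
have aa : (`|a1| : R) <= a1 by rewrite ger0_norm.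
apply: le_trans (normM_le aa (normM_le U (normM_le V W))) _.
lra.
Qed.

(** Where the first switch is not fully on, the second and third oscillations
    vanish: one of the three coordinates is outside their support. *)
Lemma block_range_outer : chi1 != 1 ->
  [/\ in_range L sg (sg * L * hess2 - (-2) * hess1),
      in_range L sg ((-2) * hess0 - (-2) * hess2) &
      in_range L sg ((-2) * hess1 - sg * L * hess0)].
Proof.
move=> chi.
have out : [\/ 7/16 < `|x0|, 7/8 < `|y1| | 7/16 < `|x2|].
  have [u|u] := ltP (7/16) `|x0|; first exact: Or31.
  have [v|v] := ltP (7/8) `|y1|; first exact: Or32.
  have [w|w] := ltP (7/16) `|x2|; first exact: Or33.
  move: chi; rewrite /chi1 !z_in ?mulr1 ?eqxx ?norm2//; lra.
have [e30 e230] := e3; have [s30 s230] := s3.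
have ee2 y : 7/8 < `|y| -> e (2 * y) = 0 /\ e2 (2 * y) = 0.
  by move=> u; apply: e_out; rewrite norm2; lra.
have ee x : 7/8 < `|x| -> e x = 0 /\ e2 x = 0.
  by move=> u; apply: e_out; lra.
have ex x : 7/16 < `|x| -> e (2 * x) = 0 /\ e2 (2 * x) = 0.
  by move=> u; apply: e_out; rewrite norm2; lra.
have [E0 E1 E2] : [/\ hess0 = -1 - a1 * (e2 x0 * (s y1 * e x2)),
    hess1 = p - (L + p) * (e x0 * (s2 y1 * e x2)) &
    hess2 = h - a1 * (e x0 * (s y1 * e2 x2))].
  rewrite /hess0 /hess1 /hess2 a1E; case: out => [/y0_case ->|u|u].
  - by rewrite e30 e230 s30 s230; split; ring.
  - by have [-> ->] := ee _ u; have [-> ->] := ee2 _ u; split; ring.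
  - have [-> ->] := ex _ u; rewrite y2_case; last lra.
    by rewrite s30 s230; split; ring.
have [m1 m2] := B1 (e2b x0) (s2n y1) (e1n x2).
have [m3 m4] : - (h/2) <= a1 * (e x0 * (s y1 * e2 x2)) /\
    a1 * (e x0 * (s y1 * e2 x2)) <= h/2.
  have -> : e x0 * (s y1 * e2 x2) = e2 x2 * (s y1 * e x0) by ring.
  exact: B1.
have L1 := gain_big h1 Lh; have P0 := p0; have Ph := ph; have h1' := h1.
have lp : (`|L + p| : R) <= L + p by rewrite ger0_norm//; lra.
have [m5 m6] := norm_bounds
  (normM_le lp (normM_le (e1n x0) (normM_le (s2b y1) (e1n x2)))).
by apply: (range_outer h1 Lh sgh); rewrite ?E0 ?E1 ?E2; lra.
Qed.

(** The first switch is supported where the cut-offs of the first oscillation are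
    constant and its profile is a parabola. *)
Lemma block_strip : chi1 != 0 ->
  [/\ e x0 = 1 /\ e2 x0 = 0, e x2 = 1 /\ e2 x2 = 0 & s2 y1 = 1].
Proof.
have zz y : z y != 0 -> (`|y| : R) <= 1.
  by move=> zy; rewrite leNgt; apply: contra zy => /z_out->.
rewrite /chi1 !mulf_eq0 !negb_or => /and3P[/zz u /zz v /zz w].
move: u w; rewrite !norm2 => u w.
by split; [apply: e_in; lra|apply: e_in; lra|exact: s_in].
Qed.

(** The later oscillations change M1 only through their cut-offs in direction 1, at
    most by (a2 + 4 a3) k^2 times a constant; this is where h and h' must be
    small. *)
Let hess1_strip : chi1 != 0 -> - (3 * L/2) <= hess1 /\ hess1 <= - (L/2).
Proof.
move=> /block_strip[[ex _] [ex' _] sy].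
rewrite /hess1 ex ex' sy a1E a2E a3E.
have L1 := gain_big h1 Lh; have P0 := p0; have Ph := ph; have h1' := h1.
have Lh' := Lh; have h0 := curv2_gt0 h1.
have Lg : 16 * (16 * (L * g)) = L * h by rewrite -g1; ring.
have Lh2 : 32 * (32 * (L * h)) = L by rewrite -[RHS](mulr1 L) -[X in _ = _ * X]h1; ring.
have q1 : (`|L * h + 1| : R) <= L * h + 1 by rewrite ger0_norm//; lra.
have q2 : (`|L * g - h| : R) <= L * g by rewrite ger0_norm; lra.
have [m1 m2] := norm_bounds
  (normM_le q1 (normM_le (s2n y0) (normM_le (e2b y1) (e1n (2 * x2))))).
have n4 : (`|4 : R| : R) <= 4 by rewrite ger0_norm.
have [m3 m4] := norm_bounds (normM_le q2 (normM_le n4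
  (normM_le (e1n y0) (normM_le (e2b (2 * y1)) (s2n y2))))).
by split; lra.
Qed.

Lemma block_range_strip : chi1 != 0 -> chi2 != 1 ->
  [/\ in_range L sg (b * hess2 - b * hess1),
      in_range L sg (b * hess0 - (- a) * hess2) &
      in_range L sg ((- a) * hess1 - b * hess0)].
Proof.
move=> chi chi'; have [mm1 mm2] := hess1_strip chi.
have [[ex ex2] [ex' ex2'] sy] := block_strip chi.
have [e30 e230] := e3; have [s30 s230] := s3.
have out : [\/ 7/8 < `|y0|, 7/16 < `|y1| | 7/32 < `|x2|].
  have [u|u] := ltP (7/8) `|y0|; first exact: Or31.
  have [v|v] := ltP (7/16) `|y1|; first exact: Or32.
  have [w|w] := ltP (7/32) `|x2|; first exact: Or33.
  move: chi'; rewrite /chi2 !z_in ?mulr1 ?eqxx ?norm2 ?norm4//; lra.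
have [E0 E2] : hess0 = -1 + (L * h + 1) * (s2 y0 * (e y1 * e (2 * x2))) /\
    hess2 = h + a2 * (4 * (s y0 * (e y1 * e2 (2 * x2)))).
  rewrite /hess0 /hess2 a2E ex2 ex2'; case: out => [u|u|/y2_case ->].
  - have [-> ->] : e y0 = 0 /\ e2 y0 = 0 by apply: e_out; lra.
    by split; ring.
  - have [-> _] : e (2 * y1) = 0 /\ e2 (2 * y1) = 0.
      by apply: e_out; rewrite norm2; lra.
    by split; ring.
  - by rewrite s30 s230; split; ring.
have L1 := gain_big h1 Lh; have h1' := h1; have h0 := curv2_gt0 h1.
have Lh' := Lh.
have Lh2 : 32 * (32 * (L * h)) = L by rewrite -[RHS](mulr1 L) -[X in _ = _ * X]h1; ring.
have q1 : (`|L * h + 1| : R) <= L * h + 1 by rewrite ger0_norm//; lra.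
have [m1 m2] := norm_bounds
  (normM_le q1 (normM_le (s2b y0) (normM_le (e1n y1) (e1n (2 * x2))))).
have [_ _ r0 r1 _] := amplitudes.
have q2 : (`|a2| : R) <= a2 by rewrite ger0_norm.
have n4 : (`|4 : R| : R) <= 4 by rewrite ger0_norm.
have [m3 m4] := norm_bounds (normM_le q2 (normM_le n4
  (normM_le (s2n y0) (normM_le (e1n y1) (e2b (2 * x2)))))).
by apply: (range_strip h1 Lh sgh bL ah); rewrite ?E0 ?E2//; lra.
Qed.

Lemma block_rod : chi2 != 0 ->
  [/\ chi1 = 1, s2 y0 = 1, e y1 = 1 /\ e2 y1 = 0 &
      e (2 * x2) = 1 /\ e2 (2 * x2) = 0].
Proof.
have zz y : z y != 0 -> (`|y| : R) <= 1.
  by move=> zy; rewrite leNgt; apply: contra zy => /z_out->.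
rewrite /chi2 !mulf_eq0 !negb_or => /and3P[/zz u /zz v /zz w].
move: v w; rewrite norm2 norm4 => v w.
have x0s : (`|x0| : R) <= 7/32.
  by case: c0 => [[]//|E]; move: u; rewrite E norm3 => u; exfalso; lra.
split; [|exact: s_in|apply: e_in; lra|apply: e_in; rewrite norm2; lra].
rewrite /chi1 !z_in ?mulr1 ?norm2//; lra.
Qed.

Lemma block_range_rod : chi2 != 0 ->
  [/\ in_range L sg ((- b) * hess2 - sg * hess1),
      in_range L sg (sg * hess0 - (- b) * hess2) &
      in_range L sg ((- b) * hess1 - (- b) * hess0)].
Proof.
move=> chi'; have [chi sy0 [ey ey2] [ex ex2]] := block_rod chi'.
have chi_0 : chi1 != 0 by rewrite chi oner_neq0.
have [mm1 mm2] := hess1_strip chi_0.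
have [[fx fx2] [fx' fx2'] sy] := block_strip chi_0.
have E0 : hess0 = L * h + (L * g - h) * (e2 y0 * (e (2 * y1) * s y2)).
  by rewrite /hess0 fx2 sy0 ey ex a2E a3E; ring.
have E2 : hess2 = h + (L * g - h) * (e y0 * (e (2 * y1) * s2 y2)).
  by rewrite /hess2 fx2' ex2 a3E; ring.
have L1 := gain_big h1 Lh; have h1' := h1; have h0 := curv2_gt0 h1.
have Lh' := Lh.
have Lg : 16 * (16 * (L * g)) = L * h by rewrite -g1; ring.
have Lh2 : 32 * (32 * (L * h)) = L by rewrite -[RHS](mulr1 L) -[X in _ = _ * X]h1; ring.
have q2 : (`|L * g - h| : R) <= L * g by rewrite ger0_norm; lra.
have [m1 m2] := norm_bounds
  (normM_le q2 (normM_le (e2b y0) (normM_le (e1n (2 * y1)) (s2n y2)))).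
have [m3 m4] := norm_bounds
  (normM_le q2 (normM_le (e1n y0) (normM_le (e1n (2 * y1)) (s2b y2)))).
by apply: (range_rod h1 Lh sgh bL); rewrite ?E0 ?E2//; lra.
Qed.

(** On the small cubes all cut-offs equal 1 and the three profiles are parabolas. *)
Lemma block_core : (`|y0| : R) <= 1/4 -> (`|y1| : R) <= 1/4 ->
  (`|y2| : R) <= 1/4 ->
  [/\ chi1 = 1, chi2 = 1, hess0 = L * h, hess1 = - L & hess2 = L * g].
Proof.
move=> u v w.
have x0s : (`|x0| : R) <= 7/32.
  by case: c0 => [[]//|E]; move: u; rewrite E norm3 => u; exfalso; lra.
have x2s : (`|x2| : R) <= 7/32.
  by case: c2 => [[]//|E]; move: w; rewrite E norm3 => w; exfalso; lra.
have [ex0 ex0'] : e x0 = 1 /\ e2 x0 = 0 by apply: e_in; lra.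
have [ex2 ex2'] : e x2 = 1 /\ e2 x2 = 0 by apply: e_in; lra.
have [ey0 ey0'] : e y0 = 1 /\ e2 y0 = 0 by apply: e_in; lra.
have [ey1 ey1'] : e y1 = 1 /\ e2 y1 = 0 by apply: e_in; lra.
have [fy1 fy1'] : e (2 * y1) = 1 /\ e2 (2 * y1) = 0.
  by apply: e_in; rewrite norm2; lra.
have [fx2 fx2'] : e (2 * x2) = 1 /\ e2 (2 * x2) = 0.
  by apply: e_in; rewrite norm2; lra.
have sy y : (`|y| : R) <= 1/4 -> s2 y = 1 by move=> ?; apply: s_in; lra.
split.
- by rewrite /chi1 !z_in ?mulr1// ?norm2; lra.
- by rewrite /chi2 !z_in ?mulr1// ?norm2 ?norm4; lra.
- by rewrite /hess0 ex0' ey0' ey1 fx2 sy// a2E; ring.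
- by rewrite /hess1 ex0 ex2 ey1' fy1' sy// a1E; ring.
- by rewrite /hess2 ex2' fx2' ey0 fy1 sy// a3E; ring.
Qed.

Lemma block_range :
  [/\ in_range L sg ((1 - chi1) * (sg * L * hess2 - (-2) * hess1)
        + (chi1 - chi2) * (b * hess2 - b * hess1)
        + chi2 * ((- b) * hess2 - sg * hess1)),
      in_range L sg ((1 - chi1) * ((-2) * hess0 - (-2) * hess2)
        + (chi1 - chi2) * (b * hess0 - (- a) * hess2)
        + chi2 * (sg * hess0 - (- b) * hess2)) &
      in_range L sg ((1 - chi1) * ((-2) * hess1 - sg * L * hess0)
        + (chi1 - chi2) * ((- a) * hess1 - b * hess0)
        + chi2 * ((- b) * hess1 - (- b) * hess0))].
Proof.
have prod01 (u v w : R) : 0 <= u <= 1 -> 0 <= v <= 1 -> 0 <= w <= 1 ->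
    0 <= u * (v * w) <= 1.
  move=> /andP[u0 u1] /andP[v0 v1] /andP[w0 w1].
  by rewrite !mulr_ge0//= mulr_ile1 ?mulr_ge0 ?mulr_ile1.
have /andP[p1 p2] : 0 <= chi1 <= 1 by apply: prod01.
have /andP[q1 q2] : 0 <= chi2 <= 1 by apply: prod01.
have le12 : chi2 <= chi1.
  have [->//|/block_rod[-> _ _ _]] := eqVneq chi2 0.
  exact: q2.
have w1 : 0 <= 1 - chi1 by lra.
have w2 : 0 <= chi1 - chi2 by lra.
have ws : 1 - chi1 + (chi1 - chi2) + chi2 = 1 by ring.
have n1 : 1 - chi1 != 0 -> chi1 != 1 by apply: contra => /eqP->; rewrite subrr.
have n2 : chi1 - chi2 != 0 -> chi1 != 0 /\ chi2 != 1.
  move=> d; split; apply: contra d => /eqP E; apply/eqP; lra.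
by split; apply: in_range_convex => // [/n1/block_range_outer[]|/n2[u v]|
  /block_range_rod[]]//; have [] := block_range_strip u v.
Qed.

End BlockRegions.

(** * Rescaling and rotation of the axes *)

Section Coordinates.
Context {R : realType}.

Lemma ord3_ind (P : 'I_3 -> Prop) : P 0 -> P 1 -> P (1 + 1) -> forall i, P i.
Proof.
move=> P0 P1 P2 [[|[|[|//]]] i3].
- by rewrite (_ : Ordinal i3 = 0)//; exact: val_inj.
- by rewrite (_ : Ordinal i3 = 1)//; exact: val_inj.
- by rewrite (_ : Ordinal i3 = 1 + 1)//; exact: val_inj.
Qed.

Lemma ord3D : (1 + 1 + 1 = 0 :> 'I_3). Proof. exact: val_inj. Qed.

Definition tri {T : Type} (a b c : T) (i : 'I_3) : T :=
  match val i with 0%N => a | 1%N => b | _ => c end.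

Lemma prod3 (F : 'I_3 -> R) : \prod_i F i = F 0 * (F 1 * F (1 + 1)).
Proof.
rewrite !big_ord_recl big_ord0 mulr1.
by congr (F _ * (F _ * F _)); exact: val_inj.
Qed.

Lemma sum3 (F : 'I_3 -> R) : \sum_i F i = F 0 + (F 1 + F (1 + 1)).
Proof.
rewrite !big_ord_recl big_ord0 addr0.
by congr (F _ + (F _ + F _)); exact: val_inj.
Qed.

Lemma ev_nil (x : 'rV[R]_3) : ev [::] x = 0.
Proof. by rewrite /ev big_nil. Qed.

Lemma ev_cons t T (x : 'rV[R]_3) :
  ev (t :: T) x = t.1 * \prod_i t.2 i (x 0 i) + ev T x.
Proof. by rewrite /ev big_cons. Qed.

Lemma ev_cat T1 T2 (x : 'rV[R]_3) : ev (T1 ++ T2) x = ev T1 x + ev T2 x.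
Proof. by rewrite /ev big_cat. Qed.

Lemma dT_cat i T1 T2 : @dT R i (T1 ++ T2) = dT i T1 ++ dT i T2.
Proof. exact: map_cat. Qed.

Lemma ev_ge1 T (x : 'rV[R]_3) i : (1 : R) < `|x 0 i| -> ev T x = 0.
Proof.
move=> xi; rewrite /ev big1// => t _.
by rewrite (bigD1 i)//= bump_vanish// mul0r mulr0.
Qed.

Lemma D1_scale (f : R -> R) (c : R) : smooth1 f ->
  D1 (fun t => c * f t) = fun t => c * D1 f t.
Proof.
move=> sf; apply: derive_eq => x.
exact: (is_deriveZ c (smooth1_is_derive x sf)).
Qed.

Lemma DD_affine (f : R -> R) (c t : R) : smooth1 f ->
  D1 (D1 (fun t => f (c * t + 0))) t = c * (c * D1 (D1 f) (c * t + 0)).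
Proof.
move=> sf; have sf' := smooth1_derive sf.
by rewrite derive_affine// D1_scale ?derive_affine//; exact: smooth1_affine.
Qed.

End Coordinates.

Section Rescaling.
Context {R : realType}.
Variables (k : R) (K : nat).
Hypotheses (k32 : (32 : R) <= k) (kK : K%:R = k / 16).

Local Notation loc := (local_coord k K).

Lemma vanish_periodize (f : R -> R) : vanish 2 f -> vanish 1 (periodize k K f).
Proof.
move=> f0 t t1; rewrite periodizeE// local_coord_far//.
  by apply: f0; rewrite ger0_norm//; lra.
by apply: le_lt_trans t1; lra.
Qed.

Definition bump_periodize (f : R -> R) (sf : smooth1 f) (vf : vanish 2 f) : bumpfn :=
  Bump (smooth_periodize k K sf) (vanish_periodize vf).

Lemma D1_periodizeE (f : R -> R) t : smooth1 f -> vanish 2 f ->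
  D1 (periodize k K f) t = k * D1 f (loc t).
Proof.
by move=> sf vf; rewrite D1_periodize// periodizeE//; exact: vanish_D1.
Qed.

Lemma DD_periodizeE (f : R -> R) t : smooth1 f -> vanish 2 f ->
  D1 (D1 (periodize k K f)) t = k * k * D1 (D1 f) (loc t).
Proof.
move=> sf vf; have sf' := smooth1_derive sf; have vf' := vanish_D1 vf.
rewrite D1_periodize// D1_scale; last exact: smooth_periodize.
by rewrite D1_periodizeE// mulrA.
Qed.

Lemma bump4_smooth (g : @bumpfn R) : smooth1 (fun t => g (4 * t + 0)).
Proof. exact: smooth1_affine (bump_smooth g). Qed.

Lemma bump4_vanish (g : @bumpfn R) : vanish 2 (fun t => g (4 * t + 0)).
Proof. by apply: scale_vanish (bump_vanish g); lra. Qed.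

Definition bump_rescale (g : @bumpfn R) : bumpfn :=
  bump_periodize (bump4_smooth g) (bump4_vanish g).

Lemma bump_rescaleE (g : @bumpfn R) t : bump_rescale g t = g (4 * loc t).
Proof.
by rewrite /bump_rescale /= periodizeE ?addr0//; exact: bump4_vanish.
Qed.

Lemma D1_bump_rescale (g : @bumpfn R) t :
  D1 (bump_rescale g) t = 4 * k * bump_D1 g (4 * loc t).
Proof.
rewrite /bump_rescale /= D1_periodizeE; [|exact: bump4_smooth|exact: bump4_vanish].
by rewrite derive_affine ?addr0; [ring|exact: bump_smooth].
Qed.

(** Sends each small cube to the unit cube, rotating the axes so that the direction
    of negative curvature becomes direction 0 again. *)
Definition zoom (x : 'rV[R]_3) : 'rV[R]_3 := \row_i (4 * loc (x 0 (i + 1))).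

(** Copies T into all small cubes at once: since the cubes form a product set, the
    sum of the copies of a product is the product of one-dimensional periodic
    sums. *)
Definition rescale (c : R) (T : tensor) : tensor :=
  [seq (c * t.1, fun i => bump_rescale (t.2 (i - 1))) | t <- T].

Lemma shift_prod (F : 'I_3 -> R) : \prod_i F i = \prod_i F (i + 1).
Proof.
by rewrite !prod3 add0r ord3D; ring.
Qed.

Lemma ev_rescale c T x : ev (rescale c T) x = c * ev T (zoom x).
Proof.
rewrite /ev big_map mulr_sumr; apply: eq_bigr => t _ /=.
rewrite -mulrA; congr (_ * (_ * _)); rewrite shift_prod.
by apply: eq_bigr => i _; rewrite addrK mxE; exact: bump_rescaleE.
Qed.

Lemma ev_dT_rescale c i T x :
  ev (dT i (rescale c T)) x = 4 * k * c * ev (dT (i - 1) T) (zoom x).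
Proof.
rewrite /ev !big_map mulr_sumr; apply: eq_bigr => t _.
rewrite -[LHS]/(c * t.1 * \prod_j (if j == i
  then bump_D1 (bump_rescale (t.2 (j - 1))) else bump_rescale (t.2 (j - 1)))
  (x 0 j)).
rewrite -[ev_rhs in _ = _ * ev_rhs]/(t.1 * \prod_j (if j == i - 1
  then bump_D1 (t.2 j) else t.2 j) (zoom x 0 j)).
pose G j := (if j == i - 1 then bump_D1 (t.2 j) else t.2 j) (zoom x 0 j).
have -> : \prod_j G j = \prod_j G (j - 1).
  by rewrite [RHS]shift_prod; apply: eq_bigr => j _; rewrite addrK.
have GE j : G (j - 1) = (if j == i then bump_D1 (t.2 (j - 1)) else t.2 (j - 1))
    (4 * loc (x 0 j)).
  by rewrite /G (inj_eq (addIr _)) mxE subrK.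
rewrite (bigD1 i)// [in RHS](bigD1 i)// eqxx [bump_fun _ _]D1_bump_rescale GE eqxx.
rewrite (eq_bigr (fun j => G (j - 1))) => [|j ji]; first by rewrite /=; ring.
by case/andP: ji => _ /negbTE ji; rewrite GE ji; exact: bump_rescaleE.
Qed.

(** Used to differentiate twice a rescaled tensor, whose derivative is a rescaled
    tensor only as a function. *)
Lemma ev_dT_ext i T1 T2 : ev T1 =1 ev T2 -> ev (dT i T1) =1 @ev R (dT i T2).
Proof.
move=> /funext T12 x.
have d1 := is_derive_ev T1 i x; have d2 := is_derive_ev T2 i x.
rewrite T12 in d1.
by rewrite -(@derive_val _ _ _ _ _ _ _ d1) (@derive_val _ _ _ _ _ _ _ d2).
Qed.

Lemma ev_ddT_rescale c i T x :
  ev (dT i (dT i (rescale c T))) x =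
  4 * k * (4 * k * c) * ev (dT (i - 1) (dT (i - 1) T)) (zoom x).
Proof.
rewrite -ev_dT_rescale; apply: ev_dT_ext => y.
by rewrite ev_dT_rescale ev_rescale.
Qed.

End Rescaling.

(** * The iterated construction *)

Section TriTensors.
Context {R : realType}.

Lemma triE (T : Type) (a b c : T) :
  (tri a b c 0 = a) * (tri a b c 1 = b) * (tri a b c (1 + 1) = c).
Proof. by []. Qed.

Lemma ev_tri (c : R) (e f g : @bumpfn R) T (x : 'rV[R]_3) :
  ev ((c, tri e f g) :: T) x =
  c * (e (x 0 0) * (f (x 0 1) * g (x 0 (1 + 1)))) + ev T x.
Proof. by rewrite ev_cons prod3. Qed.

Lemma dT_tri (c : R) (e f g : @bumpfn R) T :
  (dT 0 ((c, tri e f g) :: T) = (c, tri (bump_D1 e) f g) :: dT 0 T) *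
  (dT 1 ((c, tri e f g) :: T) = (c, tri e (bump_D1 f) g) :: dT 1 T) *
  (dT (1 + 1) ((c, tri e f g) :: T) =
     (c, tri e f (bump_D1 g)) :: dT (1 + 1) T).
Proof.
by split; [split|]; congr ((_, _) :: _); apply/funext; elim/ord3_ind.
Qed.

Lemma dT_nil i : @dT R i [::] = [::]. Proof. by []. Qed.

End TriTensors.

(** eta is a plateau, psi a truncated parabola, zeta a plateau whose transition
    takes place beyond 7/8, where eta already vanishes. *)
Record profiles (R : realType) := Profiles {
  eta : R -> R;
  psi : R -> R;
  zeta : R -> R;
  eta_smooth : smooth1 eta;
  eta_bnd : forall y, 0 <= eta y <= 1 /\ (`|D1 (D1 eta) y| : R) <= 64;
  eta_in : forall y, (`|y| : R) <= 1/2 ->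
    [/\ eta y = 1, D1 eta y = 0 & D1 (D1 eta) y = 0];
  eta_out : forall y, 7/8 <= `|y| ->
    [/\ eta y = 0, D1 eta y = 0 & D1 (D1 eta) y = 0];
  psi_smooth : smooth1 psi;
  psi_bnd : forall y, 0 <= psi y <= 2 /\ (`|D1 (D1 psi) y| : R) <= 64;
  psi_in : forall y, (`|y| : R) <= 1 ->
    [/\ psi y = y ^+ 2 / 2, D1 psi y = y & D1 (D1 psi) y = 1];
  psi_out : forall y, 7/4 <= `|y| -> psi y = 0;
  zeta_smooth : smooth1 zeta;
  zeta01 : forall y, 0 <= zeta y <= 1;
  zeta_in : forall y, (`|y| : R) <= 7/8 -> zeta y = 1;
  zeta_out : forall y, 1 < `|y| -> zeta y = 0 }.

(** The starting Hessian is diag(-1, p, curv2) with p = curv2 at the first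
    generation and p = curv1 afterwards; gain is the factor between the Hessians
    of two generations, and the weights are the entries of the auxiliary field. *)
Record scales (R : realType) := Scales {
  freq : R;
  sites : nat;
  gain : R;
  curv2 : R;
  curv1 : R;
  weight_hi : R;
  weight_lo : R;
  weight_mid : R;
  freq32 : (32 : R) <= freq;
  sitesE : sites%:R = freq / 16;
  curv2E : 32 * (32 * curv2) = 1;
  curv1E : 16 * (16 * curv1) = curv2;
  gain_curv2 : 2 <= gain * curv2;
  weight_hiE : weight_hi * curv2 = 8 * 64;
  weight_loE : weight_lo * gain = 2;
  weight_midE : weight_mid * curv2 = 4;
  freqE : curv2 * (freq * freq) = 8 * 64 * gain }.

Section Construction.
Context {R : realType} (P : profiles R) (S : scales R).

Local Notation k := (freq S).
Local Notation K := (sites S).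
Local Notation L := (gain S).
Local Notation h := (curv2 S).
Local Notation g := (curv1 S).
Local Notation sg := (weight_hi S).
Local Notation a := (weight_mid S).
Local Notation b := (weight_lo S).
Local Notation loc := (local_coord k K).

Lemma vanishW (f : R -> R) r s : r <= s -> vanish r f -> vanish s f.
Proof. by move=> rs f0 y sy; apply: f0; exact: le_lt_trans sy. Qed.

Lemma eta_vanish : vanish 1 (eta P).
Proof. by move=> y y1; have [|->] := @eta_out _ P y; first lra. Qed.

Lemma psi_vanish : vanish 2 (psi P).
Proof. by move=> y y2; apply: psi_out; lra. Qed.

Lemma psi_vanish74 : vanish (7/4) (psi P).
Proof. by move=> y /ltW/psi_out. Qed.

Lemma scaled_smooth (f : @bumpfn R) (c : R) : smooth1 (fun t => f (c * t + 0)).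
Proof. exact: smooth1_affine (bump_smooth f). Qed.

Lemma halve_vanish (f : @bumpfn R) : vanish 1 (fun t => f (2 * t + 0)).
Proof. by apply: scale_vanish (bump_vanish f); lra. Qed.

Definition halve (f : @bumpfn R) : bumpfn :=
  Bump (scaled_smooth f 2) (halve_vanish f).

Lemma bump_vanish2 (f : @bumpfn R) : vanish 2 f.
Proof. by apply: vanishW (bump_vanish f); lra. Qed.

Definition periodic (f : @bumpfn R) : bumpfn :=
  bump_periodize (freq32 S) (sitesE S) (bump_smooth f) (bump_vanish2 f).

Definition bump_eta : bumpfn := Bump (eta_smooth P) eta_vanish.
Definition bump_zeta : bumpfn := Bump (zeta_smooth P) (@zeta_out _ P).
Definition periodic_psi : bumpfn :=
  bump_periodize (freq32 S) (sitesE S) (psi_smooth P) psi_vanish.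

(** The amplitudes are tuned so that, on the small cubes, the Hessian is exactly
    L diag(h, -1, h'). *)
Definition amp1 (p : R) : R := (L + p) / (k * k).
Definition amp2 : R := (L * h + 1) / (k * k).
Definition amp3 : R := (L * g - h) / (k * k).

(** The factors equal to a plateau localise an oscillation in the other two
    directions. *)
Definition block (p : R) : tensor :=
  [:: (- amp1 p, tri bump_eta periodic_psi bump_eta);
      (amp2, tri periodic_psi (periodic bump_eta) (halve bump_eta));
      (amp3, tri (periodic bump_eta) (periodic (halve bump_eta)) periodic_psi)].

Definition polar_outer : 'I_3 -> R := tri (-2) (sg * L) (-2).
Definition polar_strip : 'I_3 -> R := tri (- a) b b.
Definition polar_rod : 'I_3 -> R := tri (- b) (- b) sg.

Definition polar_block (i : 'I_3) : tensor :=
  [:: (polar_strip i - polar_outer i,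
       tri (halve bump_zeta) (periodic bump_zeta) (halve bump_zeta));
      (polar_rod i - polar_strip i,
       tri (periodic bump_zeta) (periodic (halve bump_zeta))
         (halve (halve bump_zeta)))].

(** The factor L/(4k)^2 multiplies the Hessian by L, as the coordinates are dilated
    by 4k. *)
Fixpoint corrector (m : nat) (p : R) : tensor :=
  if m is m'.+1 then block p ++
    rescale (freq32 S) (sitesE S) (L / (4 * k * (4 * k))) (corrector m' g)
  else [::].

(** The correction to the auxiliary field.  It is divided by L at each generation
    while the Hessian is multiplied by L, so V x M keeps its size. *)
Fixpoint polar_corrector (m : nat) (i : 'I_3) : tensor :=
  if m is m'.+1 then polar_block i ++
    rescale (freq32 S) (sitesE S) L^-1 (polar_corrector m' (i - 1))
  else [::].

Definition hess_diag m p (x : 'rV[R]_3) (i : 'I_3) : R :=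
  tri (-1) p h i + ev (dT i (dT i (corrector m p))) x.

Definition polar m (x : 'rV[R]_3) (i : 'I_3) : R :=
  polar_outer i + ev (polar_corrector m i) x.

Lemma freq_gt0 : 0 < k.
Proof. by apply: lt_le_trans (freq32 S). Qed.

Lemma periodicE (f : @bumpfn R) t : periodic f t = f (loc t).
Proof. by rewrite /= periodizeE//; [exact: freq32|exact: bump_vanish2]. Qed.

Lemma periodic_psiE t : periodic_psi t = psi P (loc t).
Proof. by rewrite /= periodizeE//; [exact: freq32|exact: psi_vanish]. Qed.

Lemma halveE (f : @bumpfn R) t : halve f t = f (2 * t).
Proof. by rewrite /= addr0. Qed.

Lemma DD_periodicE (f : @bumpfn R) t :
  bump_D1 (bump_D1 (periodic f)) t = k * k * bump_D1 (bump_D1 f) (loc t).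
Proof.
rewrite /= DD_periodizeE//; [exact: freq32|exact: bump_smooth|].
exact: bump_vanish2.
Qed.

Lemma DD_periodic_psiE t : bump_D1 (bump_D1 periodic_psi) t = k * k * D1 (D1 (psi P)) (loc t).
Proof.
rewrite /= DD_periodizeE//; [exact: freq32|exact: psi_smooth|].
exact: psi_vanish.
Qed.

Lemma DD_halveE (f : @bumpfn R) t :
  bump_D1 (bump_D1 (halve f)) t = 4 * bump_D1 (bump_D1 f) (2 * t).
Proof. by rewrite /= DD_affine ?addr0; [ring|exact: bump_smooth]. Qed.

Lemma bump_etaE t : bump_eta t = eta P t.
Proof. by []. Qed.

Lemma bump_zetaE t : bump_zeta t = zeta P t.
Proof. by []. Qed.

Lemma DD_bump_etaE t : bump_D1 (bump_D1 bump_eta) t = D1 (D1 (eta P)) t.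
Proof. by []. Qed.

Definition block_hess0 p (x : 'rV[R]_3) := hess0 (eta P) (D1 (D1 (eta P))) (psi P)
  (D1 (D1 (psi P))) (k * k) (amp1 p) amp2 amp3 (x 0 0) (x 0 (1 + 1))
  (loc (x 0 0)) (loc (x 0 1)) (loc (x 0 (1 + 1))).
Definition block_hess1 p (x : 'rV[R]_3) := hess1 (eta P) (D1 (D1 (eta P))) (psi P)
  (D1 (D1 (psi P))) (k * k) p (amp1 p) amp2 amp3 (x 0 0) (x 0 (1 + 1))
  (loc (x 0 0)) (loc (x 0 1)) (loc (x 0 (1 + 1))).
Definition block_hess2 p (x : 'rV[R]_3) := hess2 (eta P) (D1 (D1 (eta P))) (psi P)
  (D1 (D1 (psi P))) h (k * k) (amp1 p) amp2 amp3 (x 0 0) (x 0 (1 + 1))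
  (loc (x 0 0)) (loc (x 0 1)) (loc (x 0 (1 + 1))).

Definition switch_strip (x : 'rV[R]_3) :=
  chi1 (zeta P) (x 0 0) (x 0 (1 + 1)) (loc (x 0 1)).
Definition switch_rod (x : 'rV[R]_3) :=
  chi2 (zeta P) (x 0 (1 + 1)) (loc (x 0 0)) (loc (x 0 1)).

Lemma block_hess p x i :
  tri (-1) p h i + ev (dT i (dT i (block p))) x =
  tri (block_hess0 p x) (block_hess1 p x) (block_hess2 p x) i.
Proof.
move: i; apply: ord3_ind; rewrite /block.
- rewrite 3!(dT_tri _ _ _ _ _).1.1 3!(dT_tri _ _ _ _ _).1.1 dT_nil !ev_tri.
  rewrite ev_nil 2!triE (DD_periodicE bump_eta) DD_periodic_psiE !periodic_psiE
    (periodicE bump_eta) (periodicE (halve bump_eta)).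
  rewrite !(halveE bump_eta) /block_hess0 /hess0 !DD_bump_etaE !bump_etaE.
  move: (loc (x 0 0)) (loc (x 0 1)) (loc (x 0 (1 + 1))) => y0 y1 y2.
  move: (x 0 0) (x 0 1) (x 0 (1 + 1)) => x0 x1 x2.
  move: (eta P) (D1 (D1 (eta P))) (psi P) (D1 (D1 (psi P))) => e e2 s s2.
  by ring.
- rewrite 3!(dT_tri _ _ _ _ _).1.2 3!(dT_tri _ _ _ _ _).1.2 dT_nil !ev_tri.
  rewrite ev_nil 2!triE (DD_periodicE bump_eta) (DD_periodicE (halve bump_eta)) DD_periodic_psiE !periodic_psiE
    (periodicE bump_eta).
  rewrite (DD_halveE bump_eta) !(halveE bump_eta) /block_hess1 /hess1 !DD_bump_etaE !bump_etaE.
  move: (loc (x 0 0)) (loc (x 0 1)) (loc (x 0 (1 + 1))) => y0 y1 y2.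
  move: (x 0 0) (x 0 1) (x 0 (1 + 1)) => x0 x1 x2.
  move: (eta P) (D1 (D1 (eta P))) (psi P) (D1 (D1 (psi P))) => e e2 s s2.
  by ring.
- rewrite 3!(dT_tri _ _ _ _ _).2 3!(dT_tri _ _ _ _ _).2 dT_nil !ev_tri.
  rewrite ev_nil 2!triE DD_periodic_psiE !periodic_psiE
    !(periodicE bump_eta) (periodicE (halve bump_eta)).
  rewrite (DD_halveE bump_eta) !(halveE bump_eta) /block_hess2 /hess2 !DD_bump_etaE !bump_etaE.
  move: (loc (x 0 0)) (loc (x 0 1)) (loc (x 0 (1 + 1))) => y0 y1 y2.
  move: (x 0 0) (x 0 1) (x 0 (1 + 1)) => x0 x1 x2.
  move: (eta P) (D1 (D1 (eta P))) (psi P) (D1 (D1 (psi P))) => e e2 s s2.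
  by ring.
Qed.

Lemma block_field x i : polar_outer i + ev (polar_block i) x =
  polar_outer i + switch_strip x * (polar_strip i - polar_outer i) + switch_rod x * (polar_rod i - polar_strip i).
Proof.
rewrite /polar_block !ev_tri ev_nil !(periodicE bump_zeta) (periodicE (halve bump_zeta)).
rewrite (halveE (halve bump_zeta)) !(halveE bump_zeta) /switch_strip /switch_rod /chi1 /chi2 !bump_zetaE.
move: (loc (x 0 0)) (loc (x 0 1)) (loc (x 0 (1 + 1))) => y0 y1 y2.
move: (x 0 0) (x 0 1) (x 0 (1 + 1)) (polar_outer i) (polar_strip i) (polar_rod i).
move: (zeta P) => z x0 x1 x2 u v w.
(* The switch in direction 2 was built by doubling twice. *)
have -> : 2 * (2 * x2) = 4 * x2 by ring.
by ring.
Qed.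

End Construction.

Section Range.
Context {R : realType} (P : profiles R) (S : scales R).

Local Notation k := (freq S).
Local Notation K := (sites S).
Local Notation L := (gain S).
Local Notation h := (curv2 S).
Local Notation g := (curv1 S).
Local Notation sg := (weight_hi S).
Local Notation loc := (local_coord k K).

Lemma loc_cases t :
  (`|loc t| : R) <= 2 /\ (`|t| : R) <= 7/32 \/ loc t = 3.
Proof.
have [[j tj E]|[_ ->]] := local_coordP k K t; last by right.
left; split; last exact: (site_near (freq32 S) (sitesE S) tj).
by rewrite E.
Qed.

Lemma amp1E p : amp1 S p * (k * k) = L + p.
Proof. by rewrite /amp1 mulfVK// mulf_neq0 ?gt_eqF ?freq_gt0. Qed.

Lemma amp2E : amp2 S * (k * k) = L * h + 1.
Proof. by rewrite /amp2 mulfVK// mulf_neq0 ?gt_eqF ?freq_gt0. Qed.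

Lemma amp3E : amp3 S * (k * k) = L * g - h.
Proof. by rewrite /amp3 mulfVK// mulf_neq0 ?gt_eqF ?freq_gt0. Qed.

Let e01 y : 0 <= eta P y <= 1. Proof. by have [] := eta_bnd P y. Qed.
Let e2b y : (`|D1 (D1 (eta P)) y| : R) <= 64.
Proof. by have [] := eta_bnd P y. Qed.
Let e_in y : (`|y| : R) <= 1/2 -> eta P y = 1 /\ D1 (D1 (eta P)) y = 0.
Proof. by move=> /(eta_in P)[]. Qed.
Let e_out y : 7/8 <= `|y| -> eta P y = 0 /\ D1 (D1 (eta P)) y = 0.
Proof. by move=> /(eta_out P)[]. Qed.
Let s02 y : 0 <= psi P y <= 2. Proof. by have [] := psi_bnd P y. Qed.
Let s2b y : (`|D1 (D1 (psi P)) y| : R) <= 64.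
Proof. by have [] := psi_bnd P y. Qed.
Let s_in y : (`|y| : R) <= 1 -> D1 (D1 (psi P)) y = 1.
Proof. by move=> /(psi_in P)[]. Qed.
Let s_out y : 7/4 < `|y| -> psi P y = 0 /\ D1 (D1 (psi P)) y = 0.
Proof.
move=> yy; split; first exact: psi_vanish74 yy.
exact: vanish_D1 (vanish_D1 (@psi_vanish74 _ P)) _ yy.
Qed.

Let block_range_at p x (p0 : 0 <= p) (ph : p <= h) :=
  block_range e01 e2b e_in e_out s02 s2b s_in s_out (@zeta01 _ P)
    (@zeta_in _ P) (@zeta_out _ P) (curv2E S) (curv1E S) (gain_curv2 S) (weight_hiE S)
    (weight_loE S) (weight_midE S) (freqE S) p0 ph (amp1E p) amp2E amp3E
    (loc x.2) (loc_cases x.1.1) (loc_cases x.1.2).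

Let block_core_at p x0 x1 x2 :=
  @block_core R _ _ (psi P) _ _ e_in s_in (@zeta_in _ P) _ _ _ _ _ _ _ _
    (amp1E p) amp2E amp3E _ _ _ (loc x1) _ (loc_cases x0) (loc_cases x2).

Definition coefficient m p (x : 'rV[R]_3) : 'I_3 -> R :=
  crossp (polar P S m x) (hess_diag P S m p x).

Lemma block_coefficient_range p x i : 0 <= p -> p <= h ->
  in_range L sg (crossp
    (fun i => polar_outer S i + switch_strip P S x * (polar_strip S i - polar_outer S i)
                      + switch_rod P S x * (polar_rod S i - polar_strip S i))
    (tri (block_hess0 P S p x) (block_hess1 P S p x) (block_hess2 P S p x)) i).
Proof.
move=> p0 ph.
have := block_range_at (x 0 0, x 0 (1 + 1), x 0 1) p0 ph.
rewrite -[hess0 _ _ _ _ _ _ _ _ _ _ _ _ _]/(block_hess0 P S p x).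
rewrite -[hess1 _ _ _ _ _ _ _ _ _ _ _ _ _ _]/(block_hess1 P S p x).
rewrite -[hess2 _ _ _ _ _ _ _ _ _ _ _ _ _ _]/(block_hess2 P S p x).
rewrite -[chi1 _ _ _ _]/(switch_strip P S x) -[chi2 _ _ _ _]/(switch_rod P S x).
move: (block_hess0 P S p x) (block_hess1 P S p x) (block_hess2 P S p x) (switch_strip P S x) (switch_rod P S x).
move=> n0 n1 n2 c1 c2 [r0 r1 r2]; rewrite /polar_outer /polar_strip /polar_rod.
move: i; apply: ord3_ind; rewrite /crossp ?add0r ?ord3D ?add0r !triE.
- by move: r0; congr in_range; ring.
- by move: r1; congr in_range; ring.
- by move: r2; congr in_range; ring.
Qed.

Lemma correctorS m p : corrector P S m.+1 p = block P S p ++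
  rescale (freq32 S) (sitesE S) (L / (4 * k * (4 * k))) (corrector P S m g).
Proof. by []. Qed.

Lemma polar_correctorS m i : polar_corrector P S m.+1 i = polar_block P S i ++
  rescale (freq32 S) (sitesE S) L^-1 (polar_corrector P S m (i - 1)).
Proof. by []. Qed.

Lemma hess_diagS m p x i : hess_diag P S m.+1 p x i =
  tri (block_hess0 P S p x) (block_hess1 P S p x) (block_hess2 P S p x) i +
  L * ev (dT (i - 1) (dT (i - 1) (corrector P S m g))) (zoom k K x).
Proof.
rewrite /hess_diag correctorS !dT_cat ev_cat addrA block_hess; congr (_ + _).
rewrite ev_ddT_rescale; congr (_ * _).
have := freq_gt0 S; move: (k) => kk kk0.
by field; rewrite gt_eqF.
Qed.

Lemma polarS m x i : polar P S m.+1 x i =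
  polar_outer S i + switch_strip P S x * (polar_strip S i - polar_outer S i)
    + switch_rod P S x * (polar_rod S i - polar_strip S i) +
  L^-1 * ev (polar_corrector P S m (i - 1)) (zoom k K x).
Proof. by rewrite /polar polar_correctorS ev_cat addrA block_field ev_rescale. Qed.

Lemma zoom_core x : (forall j, (`|zoom k K x 0 j| : R) <= 1) ->
  forall i, (`|loc (x 0 i)| : R) <= 1/4.
Proof.
move=> zx i; have := zx (i - 1); rewrite mxE subrK normrM ger0_norm//.
by move=> ?; lra.
Qed.

Lemma gain_gt0 : 0 < L.
Proof. by apply: lt_le_trans (gain_big (curv2E S) (gain_curv2 S)); lra. Qed.

(** On the small cubes the Hessian is L times the rotated initial Hessian, and the
    auxiliary field is 1/L times the rotated initial field. *)
Lemma core_block p x i : (forall j, (`|zoom k K x 0 j| : R) <= 1) ->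
  tri (block_hess0 P S p x) (block_hess1 P S p x) (block_hess2 P S p x) i = L * tri (-1) g h (i - 1) /\
  polar_outer S i + switch_strip P S x * (polar_strip S i - polar_outer S i)
    + switch_rod P S x * (polar_rod S i - polar_strip S i) = L^-1 * polar_outer S (i - 1).
Proof.
move=> /zoom_core lx.
have [c1 c2 E0 E1 E2] :=
  block_core_at p (lx 0) (lx 1) (lx (1 + 1)).
have L0 := gain_gt0; have bE : weight_lo S = 2 / L.
  by rewrite -(weight_loE S) mulfK// gt_eqF.
have F (j : 'I_3) : polar_outer S j + switch_strip P S x * (polar_strip S j - polar_outer S j)
    + switch_rod P S x * (polar_rod S j - polar_strip S j) = polar_rod S j.
  by rewrite /switch_strip /switch_rod c1 c2; ring.
rewrite F /block_hess0 /block_hess1 /block_hess2 E0 E1 E2.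
have o0 : (0 - 1 = 1 + 1 :> 'I_3) by exact: val_inj.
have o2 : (1 + 1 - 1 = 1 :> 'I_3) by exact: val_inj.
move: i; apply: ord3_ind; rewrite ?o0 ?o2 ?subrr !triE /polar_rod /polar_outer !triE ?bE.
- by split; [|rewrite mulrN mulrC].
- by split; [rewrite mulrN1|rewrite mulrN mulrC].
- by split; [|rewrite mulrCA mulVf ?mulr1// gt_eqF].
Qed.

(** In a small cube the coefficients are those of the previous generation at the
    zoomed point, with rotated axes; elsewhere the inserted copies vanish and the
    estimate is that of the block alone. *)
Lemma coefficient_range m p x i : 0 <= p -> p <= h ->
  in_range L sg (coefficient m p x i).
Proof.
have g0h : 0 <= g <= h.
  have e1 := curv2E S; have e2 := curv1E S; apply/andP; split; lra.
elim: m p x i => [|m IHm] p x i p0 ph.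
  have hess0 : hess_diag P S 0 p x = tri (-1) p h.
    by apply/funext => j; rewrite /hess_diag /= ev_nil addr0.
  have V0 : polar P S 0 x = polar_outer S.
    by apply/funext => j; rewrite /polar /= ev_nil addr0.
  have h0 := curv2_gt0 (curv2E S); have L1 := gain_big (curv2E S) (gain_curv2 S).
  have hE := curv2E S.
  have [||||||r0 r1 r2] := @range_outer R L h sg (curv2E S) (gain_curv2 S) (weight_hiE S) (-1) p h;
    try lra.
  rewrite /coefficient hess0 V0; move: i; apply: ord3_ind;
    rewrite /crossp ?add0r ?ord3D ?add0r /polar_outer !triE.
  - exact: r0.
  - exact: r1.
  - exact: r2.
have [zx|[j zj]] : (forall j, (`|zoom k K x 0 j| : R) <= 1) \/
    exists j, (1 : R) < `|zoom k K x 0 j|.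
  have [?|/existsNP[j /negP]] := pselect (forall j, (`|zoom k K x 0 j| : R) <= 1).
    by left.
  by rewrite -ltNge => ?; right; exists j.
  have HS j : hess_diag P S m.+1 p x j = L * hess_diag P S m g (zoom k K x) (j - 1).
    by rewrite hess_diagS (core_block p j zx).1 -mulrDr.
  have VS j : polar P S m.+1 x j = L^-1 * polar P S m (zoom k K x) (j - 1).
    by rewrite polarS (core_block p j zx).2 -mulrDr.
  have -> : coefficient m.+1 p x i = coefficient m g (zoom k K x) (i - 1).
    rewrite /coefficient /crossp !HS !VS ![_ + 1 - 1]addrAC.
    have := gain_gt0; move: L => l l0.
    move: (polar _ _ _ _ _) (hess_diag _ _ _ _ _ _) (polar _ _ _ _ _) (hess_diag _ _ _ _ _ _).
    by move=> A B C D; field; rewrite gt_eqF.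
  by apply: IHm; case/andP: g0h.
have -> : coefficient m.+1 p x i = crossp
    (fun i => polar_outer S i + switch_strip P S x * (polar_strip S i - polar_outer S i)
                      + switch_rod P S x * (polar_rod S i - polar_strip S i))
    (tri (block_hess0 P S p x) (block_hess1 P S p x) (block_hess2 P S p x)) i.
  by rewrite /coefficient /crossp !hess_diagS !polarS !(ev_ge1 _ zj) !mulr0 !addr0.
exact: block_coefficient_range.
Qed.

End Range.

(** * Sup bound and gradient of the iterates *)

Section Estimates.
Context {R : realType} (P : profiles R) (S : scales R).

Local Notation k := (freq S).
Local Notation K := (sites S).
Local Notation L := (gain S).
Local Notation h := (curv2 S).
Local Notation g := (curv1 S).
Local Notation loc := (local_coord k K).

Lemma bump_eta_le1 t : (`|bump_eta P t| : R) <= 1.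
Proof. by rewrite bump_etaE; apply: unit_norm; have [] := eta_bnd P t. Qed.

Lemma periodic_eta_le1 t : (`|periodic S (bump_eta P) t| : R) <= 1.
Proof. by rewrite periodicE bump_eta_le1. Qed.

Lemma periodic_psi_le2 t : (`|periodic_psi P S t| : R) <= 2.
Proof. by rewrite periodic_psiE; have [/andP[u v] _] := psi_bnd P (loc t); rewrite ger0_norm. Qed.

Lemma amp_bounds p : 0 <= p -> p <= h ->
  [/\ 0 <= amp1 S p, 32 * (8 * amp1 S p) <= h, 0 <= amp2 S,
      32 * (64 * amp2 S) <= h & 0 <= amp3 S <= amp2 S].
Proof.
move=> p0 ph.
have [u1 u2 u3 u4 u5] := amplitudes (curv2E S) (curv1E S) (gain_curv2 S) (freqE S) p0 ph
  (amp1E S p) (amp2E S) (amp3E S).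
split=> //; rewrite u5 /=.
have kk : 0 < k * k by rewrite mulr_gt0 ?freq_gt0.
rewrite -(ler_pM2r kk) amp2E amp3E.
have h0 := curv2_gt0 (curv2E S); have gE := curv1E S; have L0 := gain_gt0 S.
have : L * g <= L * h by rewrite ler_pM2l; lra.
lra.
Qed.

Lemma block_small p x : 0 <= p -> p <= h -> (`|ev (block P S p) x| : R) <= h / 64.
Proof.
move=> p0 ph; have [a1 a1' a2 a2' /andP[a3 a3']] := amp_bounds p0 ph.
rewrite /block !ev_tri ev_nil addr0 (halveE (bump_eta P)) (periodicE S (halve (bump_eta P))).
rewrite (halveE (bump_eta P)).
have n1 : (`|- amp1 S p| : R) <= amp1 S p by rewrite normrN ger0_norm.
have n2 : (`|amp2 S| : R) <= amp2 S by rewrite ger0_norm.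
have n3 : (`|amp3 S| : R) <= amp2 S by rewrite ger0_norm.
have t1 := normM_le n1 (normM_le (bump_eta_le1 (x 0 0))
  (normM_le (periodic_psi_le2 (x 0 1)) (bump_eta_le1 (x 0 (1 + 1))))).
have t2 := normM_le n2 (normM_le (periodic_psi_le2 (x 0 0))
  (normM_le (periodic_eta_le1 (x 0 1)) (bump_eta_le1 (2 * x 0 (1 + 1))))).
have t3 := normM_le n3 (normM_le (periodic_eta_le1 (x 0 0))
  (normM_le (bump_eta_le1 (2 * loc (x 0 1))) (periodic_psi_le2 (x 0 (1 + 1))))).
apply: le_trans (ler_normD _ _) _.
apply: le_trans (lerD t1 (le_trans (ler_normD _ _) (lerD t2 t3))) _.
lra.
Qed.

Lemma curv1_range : 0 <= g /\ g <= h.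
Proof. by have e1 := curv2E S; have e2 := curv1E S; split; lra. Qed.

Lemma corrector_small m p x : 0 <= p -> p <= h ->
  (`|ev (corrector P S m p) x| : R) <= h / 32.
Proof.
have h0 := curv2_gt0 (curv2E S).
elim: m p x => [|m IHm] p x p0 ph.
  by rewrite ev_nil normr0; lra.
have [g0 gh] := curv1_range.
rewrite correctorS ev_cat ev_rescale.
have c : (`|L / (4 * k * (4 * k))| : R) <= 1/2.
  have k0 := freq_gt0 S; have L0 := gain_gt0 S.
  have kk : 0 < 4 * k * (4 * k) by rewrite !mulr_gt0.
  rewrite ger0_norm; last by rewrite divr_ge0// ltW.
  rewrite ler_pdivrMr//.
  have -> : 1 / 2 * (4 * k * (4 * k)) = 8 * (k * k) by field.
  rewrite -(ler_pM2l h0) (mulrCA h 8) (freqE S).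
  have hL : h * L <= 1 * L by rewrite ler_pM2r//; have e1 := curv2E S; lra.
  lra.
apply: le_trans (ler_normD _ _) _.
apply: le_trans (lerD (block_small x p0 ph) (normM_le c (IHm g _ g0 gh))) _.
lra.
Qed.

(** The gradient of half the quadratic form diag(-1, p, h) plus the corrector. *)
Definition unit_grad m p (x : 'rV[R]_3) (i : 'I_3) : R :=
  tri (-1) p h i * x 0 i + ev (dT i (corrector P S m p)) x.

Lemma D_periodicE (f : @bumpfn R) t :
  bump_D1 (periodic S f) t = k * bump_D1 f (loc t).
Proof.
rewrite /= D1_periodizeE//; [exact: freq32|exact: bump_smooth|].
exact: bump_vanish2.
Qed.

Lemma D_periodic_psiE t : bump_D1 (periodic_psi P S) t = k * D1 (psi P) (loc t).
Proof.
rewrite /= D1_periodizeE//; [exact: freq32|exact: psi_smooth|].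
exact: psi_vanish.
Qed.

Lemma D_halveE (f : @bumpfn R) t :
  bump_D1 (halve f) t = 2 * bump_D1 f (2 * t).
Proof. by rewrite /= derive_affine ?addr0//; exact: bump_smooth. Qed.

Lemma quarter2 (t : R) : (`|t| : R) <= 1/4 -> (`|t| : R) <= 2.
Proof. by move=> ?; lra. Qed.

Lemma block_grad p i (j : 'I_3 -> 'I_K) : exists xi : R, forall x : 'rV[R]_3,
  (forall i, (`|k * x 0 i + - (k * site k (j i))| : R) <= 1/4) ->
  tri (-1) p h i * x 0 i + ev (dT i (block P S p)) x =
  L * tri (-1) g h (i - 1) * x 0 i + xi.
Proof.
pose r : R := tri (- (amp2 S * (k * k))) (amp1 S p * (k * k))
  (- (amp3 S * (k * k))) i * site k (j i).
exists r => x xj.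
have lj q : loc (x 0 q) = k * x 0 q + - (k * site k (j q)).
  by apply: (local_coord_site (freq32 S)); apply: quarter2.
have ly q : (`|loc (x 0 q)| : R) <= 1/4 by rewrite lj.
have lx q : (`|x 0 q| : R) <= 7/32.
  by have [[]//|E] := loc_cases S (x 0 q); have := ly q; rewrite E ger0_norm// => ?; exfalso; lra.
have h1 t : (`|t| : R) <= 1/4 -> (`|t| : R) <= 1/2 by move=> ?; lra.
have h2 t : (`|t| : R) <= 1/4 -> (`|2 * t| : R) <= 1/2.
  by rewrite normrM ger0_norm// => ?; lra.
have in1 t : (`|t| : R) <= 1/4 -> bump_eta P t = 1 /\ bump_D1 (bump_eta P) t = 0.
  by move=> /h1/(eta_in P)[].
have in2 t : (`|t| : R) <= 1/4 -> bump_eta P (2 * t) = 1 /\ bump_D1 (bump_eta P) (2 * t) = 0.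
  by move=> /h2/(eta_in P)[].
have lx' q : (`|x 0 q| : R) <= 1/4 by have := lx q; lra.
have [e0 e0'] := in1 _ (lx' 0); have [e2 e2'] := in1 _ (lx' (1 + 1)).
have [f2 f2'] := in2 _ (lx' (1 + 1)).
have [y0 y0'] := in1 _ (ly 0); have [y1 y1'] := in1 _ (ly 1).
have [z1 z1'] := in2 _ (ly 1).
have dpsi q : D1 (psi P) (loc (x 0 q)) = k * x 0 q + - (k * site k (j q)).
  by have [|_ -> _] := psi_in P (y := loc (x 0 q)); [have := ly q; lra|].
have o0 : (0 - 1 = 1 + 1 :> 'I_3) by exact: val_inj.
have o2 : (1 + 1 - 1 = 1 :> 'I_3) by exact: val_inj.
have b1 := amp1E S p; have b2 := amp2E S; have b3 := amp3E S.
rewrite /r; move: i {r}; apply: ord3_ind; rewrite /block ?o0 ?o2 ?subrr.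
- rewrite 3!(dT_tri _ _ _ _ _).1.1 dT_nil !ev_tri ev_nil 3!triE.
  rewrite (D_periodicE (bump_eta P)) D_periodic_psiE (periodicE S (bump_eta P)) (halveE (bump_eta P)).
  rewrite e0' y0' y1 f2 dpsi.
  transitivity (- x 0 0 + amp2 S * (k * k) * (x 0 0 - site k (j 0))); first by ring.
  by rewrite b2; ring.
- rewrite 3!(dT_tri _ _ _ _ _).1.2 dT_nil !ev_tri ev_nil 3!triE.
  rewrite (D_periodicE (bump_eta P)) (D_periodicE (halve (bump_eta P))) D_periodic_psiE.
  rewrite (D_halveE (bump_eta P)) (halveE (bump_eta P)).
  rewrite e0 e2 y1' z1' dpsi.
  transitivity (p * x 0 1 - amp1 S p * (k * k) * (x 0 1 - site k (j 1))); first by ring.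
  by rewrite b1; ring.
- rewrite 3!(dT_tri _ _ _ _ _).2 dT_nil !ev_tri ev_nil 3!triE.
  rewrite D_periodic_psiE !(periodicE S (bump_eta P)) (periodicE S (halve (bump_eta P))) (D_halveE (bump_eta P)).
  rewrite (halveE (bump_eta P)) e2' f2' y0 z1 dpsi.
  transitivity (h * x 0 (1 + 1) +
    amp3 S * (k * k) * (x 0 (1 + 1) - site k (j (1 + 1)))); first by ring.
  by rewrite b3; ring.
Qed.

(** The one-dimensional centres of generation m; the cubes of generation m are
    centred at the triples of such points, with half-side [cradius m]. *)
Fixpoint centers (m : nat) : seq R :=
  if m is m'.+1
  then [seq site k j + c / (4 * k) | j <- iota 0 K, c <- centers m']
  else [:: 0].

Definition cradius m : R := (4 * k) ^- m.

Lemma cradius_gt0 m : 0 < cradius m.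
Proof. by rewrite invr_gt0 exprn_gt0// mulr_gt0// freq_gt0. Qed.

Lemma cradiusS m : cradius m = 4 * k * cradius m.+1.
Proof.
have k0 : 4 * k != 0 by rewrite mulf_neq0 ?gt_eqF ?freq_gt0.
by rewrite /cradius exprS invfM mulrA mulfV// mul1r.
Qed.

Lemma cradius0 : cradius 0 = 1.
Proof. by rewrite /cradius expr0 invr1. Qed.

Lemma site_small (j : 'I_K) : (`|site k j| : R) <= 7/32.
Proof. by apply: (@site_near _ k K (freq32 S) (sitesE S) j); rewrite subrr normr0. Qed.

Lemma centersSP m c : c \in centers m.+1 ->
  exists (j : 'I_K) c', c' \in centers m /\ c = site k j + c' / (4 * k).
Proof.
move=> /allpairsP[[j c']] /= [jK c'm ->].
by rewrite mem_iota add0n in jK; exists (Ordinal jK), c'.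
Qed.

Lemma center_inside m c : c \in centers m -> (`|c| : R) + cradius m <= 1.
Proof.
have k0 := freq_gt0 S; have kb := freq32 S.
have k1 : 0 < 4 * k by lra.
elim: m c => [|m IHm] c.
  by rewrite inE => /eqP->; rewrite normr0 add0r cradius0.
move=> /centersSP[j [c' [/IHm c'm ->]]].
have s := site_small j; rewrite cradiusS in c'm.
apply: le_trans (_ : (`|site k j| : R) + (`|c'| / (4 * k) + cradius m.+1) <= _).
  rewrite addrA lerD2r; apply: le_trans (ler_normD _ _) _.
  by rewrite lerD2l normrM normfV (gtr0_norm k1).
have : `|c'| / (4 * k) + cradius m.+1 <= 1/4.
  rewrite -(ler_pM2r k1) mulrDl mulfVK ?gt_eqF// [_ * (4 * k)]mulrC.
  by apply: le_trans c'm _; lra.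
by move=> ?; lra.
Qed.

Lemma site_localize m (j : 'I_K) c' t : c' \in centers m ->
  (`|t - (site k j + c' / (4 * k))| : R) <= cradius m.+1 ->
  (`|k * t + - (k * site k j)| : R) <= 1/4 /\
  (`|4 * (k * t + - (k * site k j)) - c'| : R) <= cradius m.
Proof.
move=> c'm tj; have k0 := freq_gt0 S; have k1 : 0 < 4 * k by lra.
have E : 4 * (k * t + - (k * site k j)) - c' =
    4 * k * (t - (site k j + c' / (4 * k))).
  by field; rewrite gt_eqF.
have n : (`|4 * (k * t + - (k * site k j)) - c'| : R) <= cradius m.
  by rewrite E normrM (gtr0_norm k1) cradiusS ler_pM2l.
split=> //.
have [n1 n2] := norm_bounds n.
have [c1 c2] := norm_bounds (lexx (`|c'| : R)).
have ci := center_inside c'm.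
by rewrite ler_norml; apply/andP; split; lra.
Qed.

(** The intervals of one generation are disjoint: a point determines first its site
    and then, after zooming, its centre of the previous generation. *)
Lemma center_unique m c1 c2 t : c1 \in centers m -> c2 \in centers m ->
  (`|t - c1| : R) <= cradius m -> (`|t - c2| : R) <= cradius m -> c1 = c2.
Proof.
elim: m c1 c2 t => [|m IHm] c1 c2 t.
  by rewrite !inE => /eqP-> /eqP->.
move=> /centersSP[j1 [d1 [D1m ->]]] /centersSP[j2 [d2 [D2m ->]]] t1 t2.
have [u1 v1] := site_localize D1m t1; have [u2 v2] := site_localize D2m t2.
have jj : j1 = j2 :> nat.
  by apply: (site_inj (freq32 S) (quarter2 u1) (quarter2 u2)).
by rewrite -jj in v2 *; rewrite (IHm _ _ _ D1m D2m v1 v2).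
Qed.

Lemma centers_uniq m : uniq (centers m).
Proof.
elim: m => [//|m IHm]; apply: allpairs_uniq => //; first exact: iota_uniq.
move=> [j1 d1] [j2 d2] /allpairsP[[i1 e1] /= [i1K e1m [-> ->]]].
move=> /allpairsP[[i2 e2] /= [i2K e2m [-> ->]]] E.
rewrite mem_iota add0n in i1K; rewrite mem_iota add0n in i2K.
have r0 := cradius_gt0 m.+1.
have t1 : (`|site k i1 + e1 / (4 * k)
    - (site k (Ordinal i1K) + e1 / (4 * k))| : R) <= cradius m.+1.
  by rewrite subrr normr0 ltW.
have t2 : (`|site k i1 + e1 / (4 * k)
    - (site k (Ordinal i2K) + e2 / (4 * k))| : R) <= cradius m.+1.
  by rewrite E subrr normr0 ltW.
have [u1 _] := site_localize e1m t1; have [u2 _] := site_localize e2m t2.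
have jj : i1 = i2.
  by apply: (site_inj (freq32 S) (quarter2 u1) (quarter2 u2)).
move: E; rewrite -jj => /addrI/mulIf; rewrite invr_eq0.
have k0 := freq_gt0 S.
by move=> ->//; rewrite mulf_neq0// gt_eqF.
Qed.

Lemma size_centers m : size (centers m) = (K ^ m)%N.
Proof.
elim: m => [//|m IHm]; rewrite /centers -/centers size_allpairs size_iota IHm.
by rewrite expnS.
Qed.

(** The direction of negative curvature rotates with the generation, whence the
    component m mod 3. *)
Lemma unit_grad_affine m p (c : 'I_3 -> R) : (forall i, c i \in centers m) ->
  exists xi : R, forall x : 'rV[R]_3,
  (forall i, (`|x 0 i - c i| : R) <= cradius m) ->
  unit_grad m p x m%:R = - L ^+ m * x 0 m%:R + xi.
Proof.
elim: m p c => [|m IHm] p c cm.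
  by exists 0 => x _; rewrite /unit_grad /dT /= ev_nil triE expr0 mulN1r.
have /choice[jc jcP] : forall i, exists jc : 'I_K * R,
    jc.2 \in centers m /\ c i = site k jc.1 + jc.2 / (4 * k).
  by move=> i; have [j [c' ?]] := centersSP (cm i); exists (j, c').
have [xi1 H1] := block_grad p (m.+1)%:R (fun i => (jc i).1).
have [|xi2 H2] := IHm g (fun i => (jc (i + 1)).2).
  by move=> i; have [] := jcP (i + 1).
pose i : 'I_3 := m.+1%:R.
have im : i - 1 = m%:R by rewrite /i -natr1 addrK.
exists (xi1 + L / (4 * k) * xi2 + (L ^+ m.+1 + L * tri (-1) g h (i - 1)) * site k (jc i).1).
move=> x xc.
have k0 := freq_gt0 S.
have lo q : (`|k * x 0 q + - (k * site k (jc q).1)| : R) <= 1/4 /\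
    (`|4 * (k * x 0 q + - (k * site k (jc q).1)) - (jc q).2| : R) <= cradius m.
  have [c'm cE] := jcP q; apply: site_localize c'm _.
  by rewrite -cE.
have lj q : loc (x 0 q) = k * x 0 q + - (k * site k (jc q).1).
  by apply: (local_coord_site (freq32 S)); apply: quarter2; have [] := lo q.
have {}H1 := H1 x (fun q => (lo q).1).
have {}H2 : unit_grad m g (zoom k K x) m%:R = _ := H2 (zoom k K x) _.
rewrite /unit_grad correctorS dT_cat ev_cat addrA H1 ev_dT_rescale im.
have H3 : ev (dT m%:R (corrector P S m g)) (zoom k K x) =
    - L ^+ m * zoom k K x 0 m%:R + xi2 - tri (-1) g h m%:R * zoom k K x 0 m%:R.
  rewrite -H2; first by rewrite /unit_grad; ring.
  by move=> q; rewrite mxE lj; have [] := lo (q + 1).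
rewrite H3 mxE natr1 lj.
have -> : 4 * k * (L / (4 * k * (4 * k))) = L / (4 * k).
  by field; rewrite gt_eqF.
rewrite -/i exprS.
move: (tri _ _ _ _) (site _ _) (x 0 i) (L ^+ m) => w s y l.
by field; rewrite gt_eqF.
Qed.

End Estimates.

(** * The solutions and their coefficients *)

Section Solution.
Context {R : realType} (P : profiles R) (S : scales R).

Local Notation k := (freq S).
Local Notation K := (sites S).
Local Notation L := (gain S).
Local Notation h := (curv2 S).
Local Notation g := (curv1 S).

Definition halveT (T : @tensor R) : tensor :=
  [seq (t.1, fun i => halve (t.2 i)) | t <- T].

Lemma ev_halveT T (x : 'rV[R]_3) : ev (halveT T) x = ev T (2 *: x).
Proof.
rewrite /ev big_map; apply: eq_bigr => t _; congr (_ * _).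
by apply: eq_bigr => i _; rewrite mxE -[LHS]/(halve (t.2 i) _) halveE.
Qed.

Lemma dT_halveT i T (x : 'rV[R]_3) :
  ev (dT i (halveT T)) x = 2 * ev (halveT (dT i T)) x.
Proof.
rewrite /ev !big_map mulr_sumr; apply: eq_bigr => t _.
rewrite [RHS]mulrCA; congr (_ * _).
rewrite (bigD1 i)//= [in RHS](bigD1 i)//= !eqxx mulrA; congr (_ * _).
  by rewrite addr0; exact: D_halveE.
by apply: eq_bigr => j /negbTE ji; rewrite ji.
Qed.

Lemma ddT_halveT i T (x : 'rV[R]_3) :
  ev (dT i (dT i (halveT T))) x = 4 * ev (dT i (dT i T)) (2 *: x).
Proof.
pose T2 : tensor := [seq (2 * t.1, t.2) | t <- halveT (dT i T)].
have evT2 U y : ev [seq (2 * t.1, t.2) | t <- U] y = 2 * @ev R U y.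
  by rewrite /ev big_map mulr_sumr; apply: eq_bigr => t _; rewrite mulrA.
have -> : ev (dT i (dT i (halveT T))) x = ev (dT i T2) x.
  by apply: ev_dT_ext => y; rewrite evT2 dT_halveT.
have -> : dT i T2 = [seq (2 * t.1, t.2) | t <- dT i (halveT (dT i T))].
  by rewrite /T2 /dT -!map_comp.
rewrite evT2 dT_halveT ev_halveT mulrA; congr (_ * _).
by ring.
Qed.

(** Chosen so that 1 - x_0^2/2 + t (|x|^2 - 4) with 2 t = quad_amp * h has Hessian
    quad_amp * diag(-1, h, h). *)
Definition quad_amp : R := (1 + h)^-1.

Lemma curv2_small : 0 < h /\ 32 * h <= 1.
Proof. by have e1 := curv2E S; split; lra. Qed.

Lemma quad_ampE : quad_amp * (1 + h) = 1.
Proof. by have [h0 _] := curv2_small; rewrite mulVf// gt_eqF//; lra. Qed.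

Lemma quad_amp_gt0 : 0 < quad_amp.
Proof. by have [h0 _] := curv2_small; rewrite invr_gt0; lra. Qed.

Definition quadratic_part (x : 'rV[R]_3) : R :=
  1 - x 0 0 ^+ 2 / 2 +
  quad_amp * h / 2 * (x 0 0 ^+ 2 + (x 0 1 ^+ 2 + x 0 (1 + 1) ^+ 2) - 4).

(** The unit cell [-1, 1]^3 is shrunk by 2 to fit in the cube of side 1. *)
Definition solution (m : nat) (x : 'rV[R]_3) : R :=
  quadratic_part x + quad_amp / 4 * ev (halveT (corrector P S m h)) x.

Lemma smooth1_sqr : smooth1 (fun t : R => t ^+ 2).
Proof.
rewrite (_ : (fun t : R => t ^+ 2) = id \* id).
  by apply: smoothM; exact: smooth1_id.
by apply/funext => t; rewrite expr2.
Qed.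

Lemma smooth3_sqr i : smooth3 (fun x : 'rV[R]_3 => x 0 i ^+ 2).
Proof. exact: (smooth3_coord i smooth1_sqr). Qed.

Lemma quadratic_part_sum x : quadratic_part x = 1 - 2 * (quad_amp * h) +
  \sum_i (quad_amp / 2 * tri (-1) h h i) * x 0 i ^+ 2.
Proof.
have E : 1 / 2 = quad_amp / 2 + quad_amp * h / 2 by have := quad_ampE => r; lra.
rewrite /quadratic_part sum3 !triE.
have -> : x 0 0 ^+ 2 / 2 = x 0 0 ^+ 2 * (1 / 2) by rewrite mul1r.
by rewrite E; field.
Qed.

Lemma quadratic_part_fun : quadratic_part = (cst (1 - 2 * (quad_amp * h)) \+
  (fun x => \sum_(i <- index_enum 'I_3)
     (cst (quad_amp / 2 * tri (-1) h h i) \* (fun x : 'rV[R]_3 => x 0 i ^+ 2)) x)).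
Proof. by apply/funext => x; rewrite quadratic_part_sum. Qed.

Lemma smooth3_quadratic_part : smooth3 quadratic_part.
Proof.
rewrite quadratic_part_fun; apply: smoothD; first exact: smooth_cst.
apply: smooth_sum => i; apply: smoothM; first exact: smooth_cst.
exact: smooth3_sqr.
Qed.

Lemma smooth3_solution m : smooth3 (solution m).
Proof.
apply: (@smoothD _ _ _ _ quadratic_part); first exact: smooth3_quadratic_part.
apply: (@smoothM _ _ _ _ (cst (quad_amp / 4))); first exact: smooth_cst.
exact: smooth3_ev.
Qed.

Lemma is_derive_quadratic_part x i :
  is_derive x (dir i) quadratic_part (quad_amp * tri (-1) h h i * x 0 i).
Proof.
have E (c : R) : quadratic_part (c *: dir i + x) = quadratic_part x
    + c * (quad_amp * tri (-1) h h i * x 0 i) + c * c * (quad_amp / 2 * tri (-1) h h i).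
  rewrite !quadratic_part_sum !sum3 !dirE.
  have eqs : ((0 == 1 :> 'I_3) = false) * ((0 == 1 + 1 :> 'I_3) = false) *
     ((1 == 0 :> 'I_3) = false) * ((1 == 1 + 1 :> 'I_3) = false) *
     ((1 + 1 == 0 :> 'I_3) = false) * ((1 + 1 == 1 :> 'I_3) = false) by [].
  by move: i; apply: ord3_ind; rewrite !triE ?eqs ?eqxx /=; field.
apply: (is_derive_line E).
have d := is_derive_id (0 : R) (1 : R).
set A := quad_amp * _ * _; set B := quad_amp / 2 * _.
apply: (is_derive_ext (is_deriveD (is_deriveD (is_derive_cst (quadratic_part x) (0 : R) (1 : R))
  (is_deriveM d (is_derive_cst A (0 : R) (1 : R))))
  (is_deriveM (is_deriveM d d) (is_derive_cst B (0 : R) (1 : R))))) => //.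
by rewrite /GRing.scale/=; ring.
Qed.

Lemma partial_solution m i x :
  partial i (solution m) x = quad_amp / 2 * unit_grad P S m h (2 *: x) i.
Proof.
have d1 := is_derive_quadratic_part x i.
have d2 := is_derive_ev (halveT (corrector P S m h)) i x.
have d := is_deriveD d1 (is_deriveZ (quad_amp / 4) d2).
have d' : is_derive x (dir i) (solution m) _ := d.
rewrite /partial (@derive_val _ _ _ _ _ _ _ d') dT_halveT ev_halveT /unit_grad mxE.
by rewrite /GRing.scale/=; field.
Qed.

Lemma partial_partial_solution m i x :
  partial i (partial i (solution m)) x = quad_amp * hess_diag P S m h (2 *: x) i.
Proof.
have E : partial i (solution m) = (fun x => quad_amp * tri (-1) h h i * x 0 i +
    quad_amp / 4 * ev (dT i (halveT (corrector P S m h))) x).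
  apply/funext => y; rewrite partial_solution dT_halveT ev_halveT /unit_grad mxE.
  by field.
have d1 : is_derive x (dir i) (fun x : 'rV[R]_3 => x 0 i) 1.
  have := is_derive_coord i i x (@smooth1_id R); rewrite eqxx.
  have -> : D1 id = cst (1 : R) by apply: derive_eq => t; exact: is_derive_id.
  by [].
have d2 := is_derive_ev (dT i (halveT (corrector P S m h))) i x.
have d := is_deriveD (is_deriveZ (quad_amp * tri (-1) h h i) d1)
  (is_deriveZ (quad_amp / 4) d2).
have d' : is_derive x (dir i) (fun x : 'rV[R]_3 => quad_amp * tri (-1) h h i * x 0 i +
    quad_amp / 4 * ev (dT i (halveT (corrector P S m h))) x) _ := d.
rewrite E /partial (@derive_val _ _ _ _ _ _ _ d').
rewrite ddT_halveT /hess_diag /GRing.scale/=.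
by field.
Qed.

Definition coefficient_matrix (m : nat) (x : 'rV[R]_3) : 'M[R]_3 :=
  diag_mx (\row_i coefficient P S m h (2 *: x) i).

Lemma smooth3_polar m i : smooth3 (fun x => polar P S m (2 *: x) i).
Proof.
rewrite (_ : (fun x => _) = cst (polar_outer S i) \+ ev (halveT (polar_corrector P S m i))).
  by apply: smoothD; [exact: smooth_cst|exact: smooth3_ev].
by apply/funext => x; rewrite /= ev_halveT.
Qed.

Lemma smooth3_hess_diag m p i : smooth3 (fun x => hess_diag P S m p (2 *: x) i).
Proof.
rewrite (_ : (fun x => _) = cst (tri (-1) p h i) \+
    ev (halveT (dT i (dT i (corrector P S m p))))).
  by apply: smoothD; [exact: smooth_cst|exact: smooth3_ev].
by apply/funext => x; rewrite /= ev_halveT.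
Qed.

Lemma smooth3_coefficient m i j : smooth3 (fun x => coefficient_matrix m x i j).
Proof.
have [ij|ij] := eqVneq i j; last first.
  rewrite (_ : (fun x => _) = cst 0); first exact: smooth_cst.
  by apply/funext => x; rewrite !mxE (negbTE ij).
rewrite (_ : (fun x => _) =
  ((fun x => polar P S m (2 *: x) (i + 1)) \*
   (fun x => hess_diag P S m h (2 *: x) (i + 1 + 1))) \+
  (cst (-1) \* ((fun x => polar P S m (2 *: x) (i + 1 + 1)) \*
   (fun x => hess_diag P S m h (2 *: x) (i + 1))))).
  apply: smoothD.
    by apply: smoothM; [exact: smooth3_polar|exact: smooth3_hess_diag].
  apply: smoothM; first exact: smooth_cst.
  by apply: smoothM; [exact: smooth3_polar|exact: smooth3_hess_diag].
by apply/funext => x; rewrite !mxE ij eqxx mulr1n /coefficient /crossp /= mulN1r.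
Qed.

Lemma smooth3_on U (f : 'rV[R]_3 -> R) : smooth3 f -> smooth_on U f.
Proof.
move=> sf s; have {}sf : smooth3 (foldr partial f s).
  elim: s => [//|i s IHs]; exact: (smooth_derive i IHs).
split=> [x _|i x _]; first exact: (smooth_continuous sf).
by have [] := smooth_is_derive i x sf.
Qed.

Lemma qform_diag (d : 'I_3 -> R) (y : 'rV[R]_3) :
  qform (diag_mx (\row_i d i)) y = \sum_i d i * y 0 i ^+ 2.
Proof.
rewrite /qform mul_mx_diag !mxE; apply: eq_bigr => i _.
by rewrite !mxE; ring.
Qed.

Lemma coefficient_ellipticity m x : form_le 1%:M (coefficient_matrix m x) /\
  form_le (coefficient_matrix m x) (2 * (weight_hi S * L))%:M.
Proof.
have scal (c : R) : c%:M = diag_mx (\row_(i < 3) c) :> 'M[R]_3.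
  by rewrite -diag_const_mx; congr diag_mx; apply/rowP => i; rewrite !mxE.
have h0 : 0 <= h by have [/ltW] := curv2_small.
have B i := @coefficient_range R P S m h (2 *: x) i h0 (lexx h).
by split=> y; rewrite scal !qform_diag; apply: ler_sum => i _;
  rewrite ler_wpM2r ?sqr_ge0//; have [] := B i.
Qed.

(** A vector is orthogonal to its cross products. *)
Lemma coefficient_equation m x : ddot (coefficient_matrix m x) (hessian (solution m) x) = 0.
Proof.
rewrite /ddot mul_diag_mx /mxtrace sum3 !mxE !partial_partial_solution.
rewrite /coefficient /crossp !add0r ord3D !add0r.
move: (polar _ _ _ _) (hess_diag _ _ _ _ _) => v w.
by ring.
Qed.

(** The boundary point is reached by continuity from outside. *)
Lemma bump_vanish_le (f : @bumpfn R) y : (1 : R) <= `|y| -> f y = 0.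
Proof.
rewrite le_eqVlt => /orP[/eqP y1|]; last exact: bump_vanish.
have c : continuous f := smooth_continuous (bump_smooth f).
have l1 : f (y * (1 + e)) @[e --> (0 : R)^'+] --> f y.
  rewrite -[in X in _ --> X](mulr1 y) -[X in f (y * X)](addr0 1).
  apply: (@cvg_at_right_filter _ _ (fun e : R => f (y * (1 + e)))).
  apply: (@continuous_comp _ _ _ (fun e : R => y * (1 + e)) f); last exact: c.
  by apply: cvgMr; apply: cvgD; [exact: cvg_cst|exact: cvg_id].
have l2 : f (y * (1 + e)) @[e --> (0 : R)^'+] --> (0 : R).
  apply: cvg_near_cst; near=> e.
  have e0 : 0 < e by near: e; exact: nbhs_right_gt.
  by apply: bump_vanish; rewrite normrM -y1 mul1r gtr0_norm; lra.
exact: (cvg_unique _ l1 l2).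
Unshelve. all: by end_near. Qed.

Lemma ev_outside T (x : 'rV[R]_3) i : (1 : R) <= `|x 0 i| -> ev T x = 0.
Proof.
move=> xi; rewrite /ev big1// => t _.
by rewrite (bigD1 i)//= bump_vanish_le// mul0r mulr0.
Qed.

Lemma solution_outside m (x : 'rV[R]_3) i : (1 / 2 : R) <= `|x 0 i| -> solution m x = quadratic_part x.
Proof.
move=> xi; rewrite /solution ev_halveT (@ev_outside _ _ i) ?mulr0 ?addr0//.
by rewrite mxE normrM ger0_norm//; lra.
Qed.

End Solution.

(** * Boundary values and sup norm *)

Section Conclusion.
Context {R : realType} (P : profiles R) (S : scales R).
Implicit Types (x : 'rV[R]_3) (i : 'I_3).

Local Notation k := (freq S).
Local Notation K := (sites S).
Local Notation L := (gain S).
Local Notation h := (curv2 S).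
Local Notation solution := (solution P S).
Local Notation quad_amp := (quad_amp S).
Local Notation quadratic_part := (quadratic_part S).

Definition sqnorm (x : 'rV[R]_3) : R := \sum_i x 0 i ^+ 2.

Lemma sqnorm3 x : sqnorm x = x 0 0 ^+ 2 + (x 0 1 ^+ 2 + x 0 (1 + 1) ^+ 2).
Proof. by rewrite /sqnorm sum3. Qed.

Lemma sqnorm_ge0 x : 0 <= sqnorm x.
Proof. by apply: sumr_ge0 => i _; exact: sqr_ge0. Qed.

Lemma enorm_lt x (r : R) : 0 < r -> (enorm x < r) = (sqnorm x < r ^+ 2).
Proof.
move=> r0; rewrite /enorm -[in LHS](ger0_norm (ltW r0)) -sqrtr_sqr ltr_sqrt//.
by rewrite exprn_gt0.
Qed.

Lemma enorm_le x (r : R) : 0 <= r -> (enorm x <= r) = (sqnorm x <= r ^+ 2).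
Proof.
by move=> r0; rewrite /enorm -[in LHS](ger0_norm r0) -sqrtr_sqr ler_sqrt// sqr_ge0.
Qed.

Lemma coord_enorm x i : (`|x 0 i| : R) <= enorm x.
Proof.
rewrite -sqrtr_sqr /enorm ler_sqrt ?sumr_ge0// => [|j _]; last exact: sqr_ge0.
by rewrite (bigD1 i)//= lerDl sumr_ge0// => j _; exact: sqr_ge0.
Qed.

Lemma continuous_enorm : continuous (@enorm R).
Proof.
have cs : continuous sqnorm.
  apply: (@smooth_continuous _ _ _ dir); apply: smooth_sum => i.
  exact: smooth3_sqr.
move=> x; apply: (@continuous_comp _ _ _ sqnorm Num.sqrt); first exact: cs.
exact: sqrt_continuous.
Qed.

Lemma boundary_ball x : boundary (eball 2) x -> sqnorm x = 4.
Proof.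
have E4 : (2 : R) ^+ 2 = 4 by rewrite expr2; ring.
move=> [cx ix]; apply/eqP; rewrite eq_le; apply/andP; split.
  have cl : closed [set y : 'rV[R]_3 | enorm y <= 2].
    apply: (@preimage_closed _ _ (@enorm R) [set z | z <= 2]).
      by move=> y _; exact: continuous_enorm.
    exact: (@closed_le R 2).
  suff : enorm x <= 2 by rewrite enorm_le// E4.
  have : closure [set y : 'rV[R]_3 | enorm y <= 2] x.
    by apply: (closureS _ cx) => y; exact: ltW.
  by rewrite -((closure_id _).1 cl).
rewrite leNgt; apply/negP => x4; apply: ix.
have op : open (eball 2 : set 'rV[R]_3).
  apply: (@open_comp _ _ (@enorm R) [set z | z < 2]).
    by move=> y _; exact: continuous_enorm.
  exact: (@open_lt R 2).
rewrite -/(interior _ _) ((interior_id _).1 op).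
by rewrite /eball /= enorm_lt// E4.
Qed.

Lemma sqr_quarter (t : R) : (`|t| : R) < 1 / 2 -> t ^+ 2 <= 1 / 4.
Proof.
move=> /ltW t2; have [_] := norm_bounds (normM_le t2 t2).
by rewrite expr2; lra.
Qed.

Lemma sphere_coord x : sqnorm x = 4 -> exists i, (1 / 2 : R) <= `|x 0 i|.
Proof.
move=> x4; apply: contrapT => /forallNP nx.
have b i : x 0 i ^+ 2 <= 1 / 4.
  by apply: sqr_quarter; rewrite ltNge; apply/negP; exact: nx.
by have := b 0; have := b 1; have := b (1 + 1); rewrite sqnorm3 in x4; lra.
Qed.

Lemma quadratic_partE x : quadratic_part x = 1 - x 0 0 ^+ 2 / 2 + quad_amp * h / 2 * (sqnorm x - 4).
Proof. by rewrite sqnorm3. Qed.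

(** Outside the cube this is elementary for the quadratic function; inside, that
    function stays below 1 by a margin of order h, larger than the corrector. *)
Lemma solution_boundary m x : sqnorm x = 4 -> solution m x = 1 - x 0 0 ^+ 2 / 2.
Proof.
move=> x4; have [i xi] := sphere_coord x4.
by rewrite (solution_outside P S m xi) quadratic_partE x4 subrr mulr0 addr0.
Qed.

Lemma solution_dirichlet m :
  has_dirichlet_data (eball 2) (solution m) (fun x => 1 - x 0 0 ^+ 2 / 2).
Proof.
exists (solution m); split=> //.
  apply: continuous_subspaceT => x.
  exact: (smooth_continuous (smooth3_solution P S m)).
by move=> x; rewrite inE => /boundary_ball; exact: solution_boundary.
Qed.

Lemma quadratic_part_quadratic : quadratic_polynomial quadratic_part.
Proof.
have [h0 h32] := curv2_small S; have r0 := quad_amp_gt0 S.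
exists (diag_mx (\row_i (quad_amp / 2 * tri (-1) h h i))), 0, (1 - 2 * (quad_amp * h)).
split.
- by rewrite tr_diag_mx.
- apply/eqP => /matrixP /(_ 0 0); rewrite !mxE eqxx mulr1n triE.
  by lra.
- move=> x; rewrite qform_diag quadratic_part_sum [X in _ = _ + X + _]big1 => [|i _].
    by ring.
  by rewrite mxE mul0r.
Qed.

Lemma solution_outside_cube m :
  {in eball 2 `\` cubeQ0, solution m =1 quadratic_part}.
Proof.
move=> x; rewrite inE => -[_ /existsNP[i /negP xi]].
apply: (solution_outside P S m (i := i)); rewrite leNgt; apply: contra xi => xi.
by rewrite -ltr_norml.
Qed.

Lemma solution_bound m x : eball 2 x -> (`|solution m x| : R) <= 1.
Proof.
have E4 : (2 : R) ^+ 2 = 4 by rewrite expr2; ring.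
rewrite /eball /= enorm_lt// E4 => x4.
have [h0 h32] := curv2_small S; have r0 := quad_amp_gt0 S; have rE := quad_ampE S.
have rh0 : 0 < quad_amp * h by rewrite mulr_gt0.
have rh1 : quad_amp * h <= 1 / 32.
  have : quad_amp * h <= 1 * h by apply: ler_wpM2r; [exact: ltW|lra].
  lra.
have q0 i : 0 <= x 0 i ^+ 2 by exact: sqr_ge0.
(* The bound is linear in the squares of the coordinates once the products with
     t = quad_amp * h / 2 are available. *)
have t1 : quad_amp * h / 2 * (sqnorm x - 4) =
    quad_amp * h / 2 * sqnorm x - 2 * (quad_amp * h) by field.
have q1 := q0 0; have q2 := q0 1; have q3 := q0 (1 + 1).
have t2 (z : R) : z <= sqnorm x -> quad_amp * h / 2 * z <= quad_amp * h / 2 * sqnorm x.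
  by move=> zx; apply: ler_wpM2l => //; lra.
have t3 (z : R) : sqnorm x <= z -> quad_amp * h / 2 * sqnorm x <= quad_amp * h / 2 * z.
  by move=> zx; apply: ler_wpM2l => //; lra.
have sE := sqnorm3 x.
have [[i xi]|nx] := pselect (exists i, (1 / 2 : R) <= `|x 0 i|).
  rewrite (solution_outside P S m xi) quadratic_partE t1 ler_norml.
  have u1 : x 0 0 ^+ 2 <= sqnorm x by lra.
  have u2 : (1 / 2 - quad_amp * h / 2) * x 0 0 ^+ 2 <= (1 / 2 - quad_amp * h / 2) * 4.
    by apply: ler_wpM2l; lra.
  have := t2 _ u1; have := t3 _ (ltW x4).
  by move=> ? ?; apply/andP; split; lra.
have b i : x 0 i ^+ 2 <= 1 / 4.
  by apply: sqr_quarter; rewrite ltNge; apply/negP => xi; apply: nx; exists i.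
have b0 := b 0; have b1 := b 1; have b2 := b (1 + 1).
have [e1 e2] := norm_bounds
  (@corrector_small R P S m h (2 *: x) (ltW h0) (lexx h)).
have e3 : quad_amp / 4 * - (h / 32) <= quad_amp / 4 * ev (corrector P S m h) (2 *: x).
  by apply: ler_wpM2l => //; lra.
have e4 : quad_amp / 4 * ev (corrector P S m h) (2 *: x) <= quad_amp / 4 * (h / 32).
  by apply: ler_wpM2l => //; lra.
rewrite /solution ev_halveT quadratic_partE t1 ler_norml.
have u3 : sqnorm x <= 3 / 4 by lra.
have := t3 _ u3; have := t2 _ (sqnorm_ge0 x).
by move=> ? ?; apply/andP; split; lra.
Qed.

End Conclusion.

(** * Lower bound for the gradient *)

Section LowerBound.
Context {R : realType} (P : profiles R) (S : scales R).
Implicit Types (x : 'rV[R]_3) (i : 'I_3).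

Local Notation k := (freq S).
Local Notation K := (sites S).
Local Notation L := (gain S).
Local Notation h := (curv2 S).

(** The integral of a nonnegative function is a supremum over simple functions, so
    monotonicity does not require measurability. *)
Lemma le_integral_nonmeasurable d (T : measurableType d)
    (mu : {measure set T -> \bar R}) (f1 f2 : T -> \bar R) :
  (forall t, 0 <= f1 t)%E -> (forall t, f1 t <= f2 t)%E ->
  (\int[mu]_t f1 t <= \int[mu]_t f2 t)%E.
Proof.
move=> f10 f12; have f20 t : (0 <= f2 t)%E := le_trans (f10 t) (f12 t).
rewrite !ge0_integralTE//; apply: le_ereal_sup => _ [w /= wf <-].
by exists w => //= t; apply: le_trans (wf t) (f12 t).
Qed.

(** An affine function of slope L^m takes absolute values at least L^m r/2 on the
    outer quarter of an interval of half-length r, on the side where it moves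
    away from zero as seen from the centre. *)
Lemma half_box_gradient m (c : 'I_3 -> R) : (forall i, c i \in centers S m) ->
  exists lohi : ('I_3 -> R) * ('I_3 -> R),
  [/\ forall i, lohi.2 i - lohi.1 i =
        (if i == m%:R then cradius S m / 4 else cradius S m),
      forall i t, lohi.1 i <= t -> t <= lohi.2 i ->
        (`|2 * t - c i| : R) <= cradius S m &
      forall x, (forall i, lohi.1 i <= x 0 i /\ x 0 i <= lohi.2 i) ->
        quad_amp S / 4 * L ^+ m * cradius S m <=
        enorm (gradient (solution P S m) x)].
Proof.
move=> cm; have [xi H] := unit_grad_affine P h cm.
have r0 := cradius_gt0 S m; set r := cradius S m in H r0 *.
have L0 : 0 < L ^+ m by rewrite exprn_gt0// gain_gt0.
have rh := quad_amp_gt0 S.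
(* The sign of the affine function at the centre selects the side. *)
pose b := - L ^+ m * c m%:R + xi <= 0.
pose lo i := if (i == m%:R) && b then (c i + r / 2) / 2 else (c i - r) / 2.
pose hi i := if (i == m%:R) && ~~ b then (c i - r / 2) / 2 else (c i + r) / 2.
have near i t : lo i <= t -> t <= hi i -> (`|2 * t - c i| : R) <= r.
  rewrite /lo /hi; case: (i == _); case: (boolP b) => /= _ u v;
    by rewrite ler_norml; apply/andP; split; lra.
exists (lo, hi); split=> //= [i|x xlh].
  by rewrite /lo /hi; case: (i == _); case: (boolP b) => /= _; lra.
have xc i : (`|(2 *: x) 0 i - c i| : R) <= r.
  by rewrite mxE; have [u v] := xlh i; exact: near.
apply: le_trans (coord_enorm _ m%:R).
rewrite mxE partial_solution (H _ xc) mxE.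
have [u v] := xlh m%:R; move: u v; rewrite /lo /hi eqxx /=.
rewrite normrM (gtr0_norm (_ : 0 < quad_amp S / 2)); last by rewrite divr_gt0.
have -> : quad_amp S / 4 * L ^+ m * r = quad_amp S / 2 * (L ^+ m * (r / 2)) by field.
move=> u v; apply: ler_wpM2l; first by rewrite divr_ge0// ltW.
move: u v; have [bT|bF] := boolP b => /= u v; rewrite ler_normr; apply/orP.
  right; have w : c m%:R + r / 2 <= 2 * x 0 m%:R by lra.
  have := ler_wpM2l (ltW L0) w; move: bT; rewrite /b; lra.
left; have w : 2 * x 0 m%:R <= c m%:R - r / 2 by lra.
have := ler_wpM2l (ltW L0) w; move: bF; rewrite /b -ltNge; lra.
Qed.

Definition box (lohi : ('I_3 -> R) * ('I_3 -> R)) :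
    set (measurableTypeR R * measurableTypeR R * measurableTypeR R) :=
  ([set` `[lohi.1 0, lohi.2 0]] `*` [set` `[lohi.1 1, lohi.2 1]])
  `*` [set` `[lohi.1 (1 + 1), lohi.2 (1 + 1)]].

Lemma measurable_box lohi : measurable (box lohi).
Proof. by apply: measurableX; [apply: measurableX|]; exact: measurable_itv. Qed.

Lemma lebesgue3_prod (A B C : set (measurableTypeR R)) :
  measurable A -> measurable B -> measurable C ->
  lebesgue3 ((A `*` B) `*` C) =
  (lebesgue_measure A * lebesgue_measure B * lebesgue_measure C)%E.
Proof.
move=> mA mB mC; have mAB : measurable (A `*` B) by exact: measurableX.
rewrite /lebesgue3 (@product_measure1E _ _ _ _ R
  ((@lebesgue_measure R) \x (@lebesgue_measure R))%E (@lebesgue_measure R)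
  _ C mAB mC).
by congr (_ * _)%E; exact: product_measure1E.
Qed.

Lemma lebesgue3_box lohi : (forall i, lohi.1 i < lohi.2 i) ->
  lebesgue3 (box lohi) = (\prod_i (lohi.2 i - lohi.1 i))%:E.
Proof.
move=> lh; rewrite /box lebesgue3_prod; [|exact: measurable_itv..].
by rewrite !lebesgue_measure_itv/= !lte_fin !lh -!EFinB -!EFinM prod3 mulrA.
Qed.

Lemma vec3E (q : measurableTypeR R * measurableTypeR R * measurableTypeR R) :
  [/\ vec3 q 0 0 = q.1.1, vec3 q 0 1 = q.1.2 & vec3 q 0 (1 + 1) = q.2].
Proof. by split; rewrite mxE. Qed.

Lemma box_vec3 lohi q : box lohi q ->
  forall i, lohi.1 i <= vec3 q 0 i /\ vec3 q 0 i <= lohi.2 i.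
Proof.
have [e0 e1 e2] := vec3E q.
rewrite /box /= !in_itv/= => -[[/andP[a0 b0] /andP[a1 b1]] /andP[a2 b2]].
by apply: ord3_ind; rewrite ?e0 ?e1 ?e2.
Qed.

Definition triples m : seq ((R * R) * R) :=
  [seq ((p.1, p.2), c) | p <- [seq (c0, c1) | c0 <- centers S m, c1 <- centers S m],
                         c <- centers S m].

Lemma triples_uniq m : uniq (triples m).
Proof.
have u := centers_uniq S m.
apply: allpairs_uniq => //; first by apply: allpairs_uniq => // -[a b] [c d] _ _ [-> ->].
by move=> [[a b] c] [[a' b'] c'] _ _ /= [-> -> ->].
Qed.

Lemma size_triples m : size (triples m) = (K ^ m * K ^ m * K ^ m)%N.
Proof. by rewrite !size_allpairs size_centers. Qed.

Lemma mem_triples m c : c \in triples m ->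
  forall i, tri c.1.1 c.1.2 c.2 i \in centers S m.
Proof.
move=> /allpairsP[[p c2]] /= [/allpairsP[[c0 c1]] /= [c0m c1m ->] c2m ->].
by apply: ord3_ind; rewrite triE.
Qed.

(** The boxes are disjoint and contained in the unit ball, so their contributions
    add up. *)
Lemma L1_lower m :
  (((quad_amp S / 4 * L ^+ m * cradius S m * (cradius S m ^+ 3 / 4))%R
     *+ (K ^ m * K ^ m * K ^ m)%N)%:E <=
  Lp_norm_on (eball 1) 1%E (fun x => enorm (gradient (solution P S m) x)))%E.
Proof.
set C := quad_amp S / 4 * L ^+ m * cradius S m.
have r0 := cradius_gt0 S m.
have C0 : 0 <= C.
  rewrite /C mulr_ge0 ?(ltW r0)// mulr_ge0//.
    by rewrite divr_ge0// ltW// quad_amp_gt0.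
  by rewrite exprn_ge0// ltW// gain_gt0.
have /choice[box_of boxP] : forall c : (R * R) * R,
    exists lohi : ('I_3 -> R) * ('I_3 -> R), c \in triples m ->
    [/\ forall i, lohi.2 i - lohi.1 i =
          (if i == m%:R then cradius S m / 4 else cradius S m),
      forall i t, lohi.1 i <= t -> t <= lohi.2 i ->
        (`|2 * t - tri c.1.1 c.1.2 c.2 i| : R) <= cradius S m &
      forall x, (forall i, lohi.1 i <= x 0 i /\ x 0 i <= lohi.2 i) ->
        C <= enorm (gradient (solution P S m) x)].
  move=> c.
  have [cm|cm] := boolP (c \in triples m); last by exists (fun=> 0, fun=> 0).
  by have [lh H] := half_box_gradient (mem_triples cm); exists lh.
rewrite /Lp_norm_on Lnorm1.
set D := \big[setU/set0]_(c <- triples m) box (box_of c).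
have DP q : D q -> exists2 c, c \in triples m & box (box_of c) q.
  rewrite /D; elim: (triples m) => [|c s IHs]; first by rewrite big_nil.
  rewrite big_cons => -[cq|/IHs[c' c's c'q]].
    by exists c => //; rewrite inE eqxx.
  by exists c' => //; rewrite inE c's orbT.
have mD : measurable D by apply: bigsetU_measurable => c _; exact: measurable_box.
apply: (@le_trans _ _ (\int[lebesgue3]_q ((cst C%:E) \_ D) q)%E); last first.
  apply: le_integral_nonmeasurable => q.
    by rewrite patchE; case: ifP => // _; rewrite lee_fin.
  rewrite patchE; case: ifPn => [|_]; last exact: abse_ge0.
  rewrite inE => /DP[c cm cq].
  have [_ b2 b3] := boxP c cm; have cv := box_vec3 cq.
  rewrite /= patchE mem_set; last first.
    rewrite /eball /= enorm_lt// expr1n.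
    have b i : vec3 q 0 i ^+ 2 <= 1 / 4.
      have [u v] := cv i; have w := b2 i _ u v.
      have ci := center_inside (mem_triples cm i).
      have [w1 w2] := norm_bounds w.
      have [c1 c2] := norm_bounds (lexx (`|tri c.1.1 c.1.2 c.2 i| : R)).
      have z : (`|vec3 q 0 i| : R) <= 1/2.
        by rewrite ler_norml; apply/andP; split; lra.
      have [_] := norm_bounds (normM_le z z).
      by rewrite expr2; lra.
    by rewrite sqnorm3; have := b 0; have := b 1; have := b (1 + 1); lra.
  rewrite /= lee_fin; apply: le_trans (ler_norm _).
  exact: b3.
rewrite -integral_mkcond ge0_integral_bigsetU//=; last 3 first.
- by move=> c; exact: measurable_box.
- exact: triples_uniq.
- move=> c c' /= cm c'm [q [cq c'q]].
  have [_ b2 _] := boxP c cm; have [_ b2' _] := boxP c' c'm.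
  have cv := box_vec3 cq; have cv' := box_vec3 c'q.
  have E i : tri c.1.1 c.1.2 c.2 i = tri c'.1.1 c'.1.2 c'.2 i.
    have [u v] := cv i; have [u' v'] := cv' i.
    apply: (center_unique (mem_triples cm i) (mem_triples c'm i)
      (t := 2 * vec3 q 0 i)); first exact: b2.
    exact: b2'.
  have := E 0; have := E 1; have := E (1 + 1); rewrite !triE.
  by case: c {cm cq b2 cv E} => [[? ?] ?]; case: c' {c'm c'q b2' cv'} => [[? ?] ?] /= -> -> ->.
rewrite (eq_big_seq (fun=> (C * (cradius S m ^+ 3 / 4))%:E)); last first.
  move=> c cm /=; rewrite integral_cst; last exact: measurable_box.
  have [b1 _ _] := boxP c cm.
  have lh i : (box_of c).1 i < (box_of c).2 i.
    by rewrite -subr_gt0 b1; case: ifP => // _; rewrite divr_gt0.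
  rewrite [X in (_ * X)%E](lebesgue3_box lh).
  rewrite -EFinM; congr (_ * _)%:E.
  rewrite (bigD1 m%:R)//= b1 eqxx (eq_bigr (fun=> cradius S m)) => [|i im].
    by rewrite prodr_const cardC1 card_ord /=; field.
  by rewrite b1 (negbTE im).
rewrite sumEFin lee_fin big_const_seq count_predT iter_addr_0 size_triples.
exact: lexx.
Qed.

End LowerBound.

(** * Choice of the parameters and conclusion *)

Section Existence.
Context {R : realType}.

Lemma profiles_exist : exists P : profiles R, True.
Proof.
have [e [e1 e2 _ e4 e5]] := @eta_exists R.
have [s [s1 s2 s3 s4]] := @psi_exists R.
have [z [z1 z2 z3 z4]] := @zeta_exists R.
by exists (Profiles e1 e2 e4 e5 s1 s2 s3 s4 z1 z2 z3 z4).
Qed.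

Lemma scales_exist : exists S : scales R,
  [/\ 2 * (weight_hi S * gain S) = 2 ^+ 81 &
      gain S * (sites S)%:R ^+ 3 = 2 * (4 * freq S) ^+ 4].
Proof.
have t0 n : (2 : R) ^+ n != 0 by rewrite expf_neq0.
have f32 : (32 : R) <= 2 ^+ 40.
  rewrite (_ : 32 = 2 ^+ 5); last by ring.
  by rewrite ler_weXn2l// ler1n.
have kE : (2 ^ 36)%:R = (2 : R) ^+ 40 / 16.
  by rewrite natrX (exprD 2 36 4); field.
have hE : 32 * (32 * (2 : R) ^- 10) = 1 by field.
have gE : 16 * (16 * (2 : R) ^- 18) = 2 ^- 10 by field.
have Lh : (2 : R) <= 2 ^+ 61 * 2 ^- 10.
  rewrite (exprD 2 51 10) mulfK// -[leLHS]expr1.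
  by rewrite ler_weXn2l// ler1n.
have vE : (2 : R) ^+ 19 * 2 ^- 10 = 8 * 64 by field.
have bE : (2 : R) ^- 60 * 2 ^+ 61 = 2.
  by rewrite (exprD 2 60 1) mulrA mulVf// mul1r expr1.
have aE : (2 : R) ^+ 12 * 2 ^- 10 = 4 by field.
have fE : (2 : R) ^- 10 * (2 ^+ 40 * 2 ^+ 40) = 8 * 64 * 2 ^+ 61.
  rewrite -exprD (exprD 2 10 70) mulrA mulVf// mul1r (exprD 2 9 61).
  by congr (_ * _); ring.
exists (Scales f32 kE hE gE Lh vE bE aE fE); split => /=.
  by rewrite -[X in X * _]expr1 -!exprD.
rewrite natrX -exprM -exprD -[X in (X * _) ^+ 4](_ : 2 ^+ 2 = 4); last by ring.
by rewrite -exprD -exprM -[X in X * _]expr1 -exprD.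
Qed.

End Existence.

Section Limit.
Context {R : realType} (P : profiles R) (S : scales R).

Lemma solution_Linfty m : (Lp_norm_on (eball 2) +oo (solution P S m) <= 1)%E.
Proof.
rewrite /Lp_norm_on unlock /=; case: ifP => _; last exact: lee01.
apply/ess_supP/nearW => q /=; rewrite patchE; case: ifPn => [|_].
  by rewrite inE => /(solution_bound P S m); rewrite /= lee_fin.
by rewrite abse0 lee01.
Qed.

Hypothesis growth : gain S * (sites S)%:R ^+ 3 = 2 * (4 * freq S) ^+ 4.

(** The hypothesis on the growth makes each generation double the lower bound. *)
Lemma solution_L1 m : ((quad_amp S / 16 * 2 ^+ m)%:E <=
  Lp_norm_on (eball 1) 1%E (fun x => enorm (gradient (solution P S m) x)))%E.
Proof.
apply: le_trans (L1_lower P S m); rewrite lee_fin -[leRHS]mulr_natr !natrM !natrX.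
have k0 : 4 * freq S != 0 by rewrite mulf_neq0// gt_eqF// freq_gt0.
rewrite le_eqVlt; apply/orP; left; apply/eqP.
have E : 2 ^+ m = gain S ^+ m * ((sites S)%:R ^+ m) ^+ 3 * (cradius S m) ^+ 4.
  rewrite -exprM mulnC exprM -exprMn growth /cradius exprVn -exprM mulnC exprM.
  by rewrite exprMn mulfK// !expf_neq0.
by rewrite E; field.
Qed.

Lemma gradient_diverges :
  (fun m : nat => Lp_norm_on (eball 1) 1%E
    (fun x => enorm (gradient (solution P S m) x))) @ \oo --> +oo%E.
Proof.
apply/cvgeyPge => A; near=> m; apply: le_trans (solution_L1 m); rewrite lee_fin.
have q0 : 0 < quad_amp S / 16 by rewrite divr_gt0// quad_amp_gt0.
rewrite -ler_pdivrMl//; apply: (@le_trans _ _ m%:R).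
  by near: m; exact: nbhs_infty_ger.
by rewrite -natrX ler_nat ltnW// ltn_expl.
Unshelve. all: by end_near. Qed.

End Limit.

Theorem theorem1p1 (R : realType) :
  exists (u : nat -> 'rV[R]_3 -> R) (A : nat -> 'rV[R]_3 -> 'M[R]_3),
    [/\ forall m : nat,
          [/\ smooth_on (eball 2) (u m),
              smooth_sym_on (eball 2) (A m),
              {in eball 2, forall x,
                 form_le 1%:M (A m x) /\ form_le (A m x) (2 ^+ 81)%:M} &
              {in eball 2, forall x, ddot (A m x) (hessian (u m) x) = 0}],
        forall m : nat,
          has_dirichlet_data (eball 2) (u m) (fun x => 1 - x 0 0 ^+ 2 / 2),
        forall m : nat, (Lp_norm_on (eball 2) +oo (u m) <= 1)%E,
        (fun m : nat =>
           Lp_norm_on (eball 1) 1%E (fun x => enorm (gradient (u m) x)))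
          @ \oo --> +oo%E &
        exists q : 'rV[R]_3 -> R,
          quadratic_polynomial q /\
          forall m : nat, {in eball 2 `\` cubeQ0, u m =1 q}].
Proof.
have [P _] := @profiles_exist R; have [S [range growth]] := @scales_exist R.
exists (solution P S), (coefficient_matrix P S); split.
- move=> m; split.
  + exact: smooth3_on (smooth3_solution P S m).
  + split=> [x _|i j]; first by rewrite tr_diag_mx.
    exact: smooth3_on (smooth3_coefficient P S m i j).
  + by move=> x _; rewrite -range; exact: coefficient_ellipticity.
  + by move=> x _; exact: coefficient_equation.
- exact: solution_dirichlet.
- exact: solution_Linfty.
- exact: gradient_diverges.
- by exists (quadratic_part S); split; [exact: quadratic_part_quadratic|exact: solution_outside_cube].
Qed.
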